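(* For every $n\ge 1$, the poset $B_n(312,\overline{312},2\overline{1},\overline{2}1)$ (with the partial order $\le$ transported from Grand-Dyck paths described in the context) is isomorphic to $B_n(213,\overline{213},1\overline{2},\overline{1}2)$ endowed with the (strong) Bruhat order induced from the hyperoctahedral group $B_n$.
   Context: Signed permutations. $B_n$ is the set of all signed permutations $\pi=\pi_1\cdots\pi_n$, i.e. permutations of $\{1,\ldots,n\}$ in which each entry may carry a sign, denoted by an overline ($\overline{k}$ is identified with $-k$, and $\overline{\overline{k}}=k$); $|\pi|\in S_n$ is obtained by removing signs. $\pi$ contains a signed pattern $\sigma=\sigma_1\cdots\sigma_m$ if there are positions $i_1<\cdots<i_m$ such that $|\pi_{i_1}|,\ldots,|\pi_{i_m}|$ are in the same relative order as $|\sigma_1|,\ldots,|\sigma_m|$ and $\pi_{i_j}$ is signed if and only if $\sigma_j$ is signed; otherwise it avoids $\sigma$. $B_n(\sigma,\tau,\ldots)$ is the set of elements of $B_n$ avoiding all the listed patterns; $\overline{312}$ and $\overline{213}$ are the patterns with all three entries signed. Bruhat order on $B_n$. Let $S_{\pm n}$ be the symmetric group on $\{\overline{n},\ldots,\overline{1},1,\ldots,n\}$, linearly ordered as indicated. To $\pi'\in B_n$ associate the element of $S_{\pm n}$ whose one-line notation is the juxtaposition of $\pi$ and $\pi'$, where $\pi$ is obtained by reversing $\pi'$ and changing all its signs. Then $\pi'\le\rho'$ in the Bruhat order of $B_n$ iff the associated elements are comparable in the same way in the strong Bruhat order of the symmetric group $S_{\pm n}$. Order on $\mathcal{GD}_n$.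 $\mathcal{GD}_n$ is the set of Grand-Dyck paths, i.e. lattice paths from $(0,0)$ to $(2n,0)$ with steps $U=(1,1)$, $D=(1,-1)$; $P(k)$ is the ordinate of $P$ at abscissa $k$, and $P\le Q$ iff $P(k)\le Q(k)$ for all $k$. Transport to partitions. Write a set partition of $\{1,\ldots,n\}$ in standard form: elements in each block in decreasing order, blocks in increasing order of their maxima. Its components are the parts of the finest splitting of this list of blocks into intervals of consecutive blocks such that the union of the blocks of each part is an interval of integers. $\widetilde{NC}(n)$ is the set of noncrossing partitions of $\{1,\ldots,n\}$ in which each component is coloured or noncoloured. Given $P\in\mathcal{GD}_n$, reflect in the $x$-axis the parts of $P$ below the $x$-axis, obtaining a Dyck path; its factors (minimal subpaths that are Dyck paths between consecutive visits to the $x$-axis) are declared coloured if they were obtained by reflection and noncoloured otherwise. Number the up steps of this Dyck path $1,\ldots,n$ from left to right and match up and down steps without crossings (as in parenthesis matching). For each maximal run of consecutive down steps, form a block consisting of the numbers of the up steps matched with the down steps of the run, coloured iff the run lies in a coloured factor. This gives a bijection $\mathcal{GD}_n\to\widetilde{NC}(n)$. Transport to permutations. The bar-removing bijection $\widetilde{NC}(n)\to B_n(312,\overline{312},2\overline{1},\overline{2}1)$ writes a partition in standard form, deletes the bars between blocks, and takes the entries in coloured components to be signed. The partial order on $B_n(312,\overline{312},2\overline{1},\overline{2}1)$ is the one transported from $\mathcal{GD}_n$ along the composition of these two bijections. *)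

(* Defs.v *)
From mathcomp Require Import all_boot all_order all_algebra.
From Stdlib Require Import Relation_Operators.

Set Implicit Arguments.
Unset Strict Implicit.
Unset Printing Implicit Defensive.

Import Order.TTheory GRing.Theory Num.Theory.
Local Open Scope ring_scope.

(* The overlined entry k is the negative integer - k. *)
Definition signed_perm (n : nat) (w : seq int) : bool :=
  perm_eq [seq `|x|%N | x <- w] (iota 1 n).

Definition contains (w s : seq int) : bool :=
  [exists i : {ffun 'I_(size s) -> 'I_(size w)},
    [forall j : 'I_(size s), forall k : 'I_(size s),
      [&& (j < k)%N ==> (i j < i k)%N,
          (`|w`_(i j)| < `|w`_(i k)|) == (`|s`_j| < `|s`_k|)
        & (w`_(i j) < 0) == (s`_j < 0)]]].

(* B_n(ps) *)
Definition avoiders (n : nat) (ps : seq (seq int)) : Type :=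
  {w : seq int | signed_perm n w && all (fun s => ~~ contains w s) ps}.

(* Permutations of a finite set of integers in one-line notation.  Exchanging
   two entries in increasing position is right multiplication by a
   transposition that raises the number of inversions. *)
Definition bruhat_step (u v : seq int) : Prop :=
  exists i j : nat,
    [/\ (i < j < size u)%N, u`_i < u`_j
      & v = set_nth 0 (set_nth 0 u i u`_j) j u`_i].

Definition bruhat_le : seq int -> seq int -> Prop :=
  clos_refl_trans (seq int) bruhat_step.

(* The element of S_{+-n} associated with a signed permutation. *)
Definition symmetric_ext (w : seq int) : seq int :=
  rev [seq - x | x <- w] ++ w.

Definition bruhatB_le n ps (x y : avoiders n ps) : Prop :=
  bruhat_le (symmetric_ext (val x)) (symmetric_ext (val y)).

(* Lattice paths are words of steps, with U = true and D = false. *)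
Definition height (P : seq bool) (k : nat) : int :=
  (count_mem true (take k P))%:Z - (count_mem false (take k P))%:Z.

Definition grand_dyck (n : nat) : Type :=
  {P : seq bool | (size P == n.*2) && (count_mem true P == n)}.

Definition gd_le n (P Q : grand_dyck n) : Prop :=
  forall k : nat, (k <= n.*2)%N -> height (val P) k <= height (val Q) k.

(* The k-th step goes from abscissa k to abscissa k + 1. *)
Definition below_axis (P : seq bool) (k : nat) : bool :=
  (height P k < 0) || (height P k.+1 < 0).

Definition reflect_path (P : seq bool) : seq bool :=
  mkseq (fun k => nth false P k (+) below_axis P k) (size P).

Definition up_label (Q : seq bool) (a : nat) : nat := count_mem true (take a.+1 Q).

(* The path strictly between the matched steps stays above its initial
   ordinate and returns to it. *)
Definition matched (Q : seq bool) (a b : nat) : bool :=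
  [&& (a < b < size Q)%N, nth false Q a, ~~ nth false Q b,
      height Q b.+1 == height Q a
    & all (fun k => height Q a < height Q k) (index_iota a.+1 b.+1)].

(* The run of down steps occupies the positions s, ..., e - 1. *)
Definition max_down_run (Q : seq bool) (s e : nat) : bool :=
  [&& (s < e <= size Q)%N,
      all (fun k => ~~ nth true Q k) (index_iota s e),
      (s == 0)%N || nth true Q s.-1
    & nth true Q e].

Definition down_runs (Q : seq bool) : seq (nat * nat) :=
  [seq r <- [seq (s, e) | s <- iota 0 (size Q).+1, e <- iota 0 (size Q).+1]
     | max_down_run Q r.1 r.2].

(* A coloured partition is a list of blocks, each with a flag telling whether it
   is coloured; neither the order of the blocks nor the order inside a block is
   meaningful.  A component of the partition of a path is the set of blocks
   coming from one factor, so its blocks all carry the same flag. *)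
Definition coloured_partition : Type := seq (seq nat * bool).

Definition run_block (Q : seq bool) (r : nat * nat) : seq nat :=
  [seq up_label Q a | a <- iota 0 (size Q) & has (matched Q a) (index_iota r.1 r.2)].

Definition partition_of_path (P : seq bool) : coloured_partition :=
  let Q := reflect_path P in
  [seq (run_block Q r, all (below_axis P) (index_iota r.1 r.2)) | r <- down_runs Q].

Definition block_max (b : seq nat) : nat := \max_(x <- b) x.

Definition standard_form (X : coloured_partition) : coloured_partition :=
  sort (fun b c => block_max b.1 <= block_max c.1)%N
    [seq (sort geq b.1, b.2) | b <- X].

Definition remove_bars (X : coloured_partition) : seq int :=
  flatten [seq [seq (if b.2 then - x%:Z else x%:Z) | x <- b.1] | b <- standard_form X].

Definition transported_le n ps (x y : avoiders n ps) : Prop :=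
  exists P Q : grand_dyck n,
    [/\ remove_bars (partition_of_path (val P)) = val x,
        remove_bars (partition_of_path (val Q)) = val y
      & gd_le P Q].

Definition order_isomorphic (S T : Type) (leS : S -> S -> Prop)
    (leT : T -> T -> Prop) : Prop :=
  exists f : S -> T,
    bijective f /\ forall x y : S, leS x y <-> leT (f x) (f y).

(* Main.v *)
Require Import Defs.
From mathcomp Require Import all_boot all_order all_algebra.
From mathcomp Require Import zify.
From Stdlib Require Import Relation_Operators.

Set Implicit Arguments.
Unset Strict Implicit.
Unset Printing Implicit Defensive.

Import Order.TTheory GRing.Theory Num.Theory.

(** Read from left to right, the down steps of the reflected path |P| pop the
labels of their matched up steps off a stack.  The runs of down steps give the
blocks in standard form, so the word attached to P lists the popped labels,
signed where P is below the axis.  The whole theorem can therefore be read off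
one sequence of nonzero integers, the profile of P: its term s d is the height
of P at the start of the d-th down step of |P|.

- A path determines its profile ([traces]); the profiles that occur are the
  [admissible] ones ([traces_admissible], [traces_exists]), and P <= Q holds
  exactly when the profiles are ordered termwise ([traces_le]).
- When the d-th pop takes place the labels up to [reach s d] = |s d| + d have
  been pushed, and the popped label is the largest one still present.  This is
  [encodes]; it determines the word from the profile ([encodes_inj]), it holds
  for the word of a path ([path_encodes]), and every word in the first avoidance
  class arises from a profile, whose reaches are the prefix maxima of absolute
  values ([encodes_exists]).

The isomorphism is the quarter turn of the diagram of a signed permutation
combined with a change of all signs: an entry +-v in position d (from 0) becomes
the entry -+(n - d) in position v - 1.  Four such turns give the identity, and
they carry pattern containment along, so this is a bijection between the two
avoidance classes ([quarter_turn4], [contains_quarter_turn]).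

It remains to compare the Bruhat order with the termwise order of profiles.  If
s <= t, one can pass from s to t raising one term at a time
([update_toward]); each such move exchanges two entries of equal sign of the
word, or changes the sign of one entry, and after the quarter turn it becomes
one or two upward transpositions of the symmetric extension
([encodes_raise], [encodes_lower], [encodes_negate], [bruhat_of_leq]).
Conversely a Bruhat step can only increase the number of entries below a given
bound from a given position on.  The value [reach s d] sits within the first d + 1
entries of the word, hence gives an extreme entry near the end of the turned
word, and such an entry cannot be lost ([leq_of_bruhat]). *)

Local Notation "s `_ i" := (@nth int 0%R s i) : ring_scope.

(** * Signed permutations and the quarter turn *)

Lemma signed_perm_size n w : signed_perm n w -> size w = n.
Proof. by move=> /perm_size; rewrite size_map size_iota. Qed.

Lemma signed_perm_uniq n w : signed_perm n w -> uniq [seq `|z|%N | z <- w].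
Proof. by move=> /perm_uniq ->; apply: iota_uniq. Qed.

Lemma signed_perm_range n w d :
  signed_perm n w -> d < n -> 0 < `|(w`_d)%R|%N <= n.
Proof.
move=> hw hd; have hs := signed_perm_size hw.
have : `|(w`_d)%R|%N \in [seq `|z|%N | z <- w].
  by apply: map_f; apply: mem_nth; rewrite hs.
by rewrite (perm_mem hw) mem_iota; lia.
Qed.

Lemma signed_perm_inj n w d e :
  signed_perm n w -> d < n -> e < n -> `|(w`_d)%R|%N = `|(w`_e)%R|%N -> d = e.
Proof.
move=> hw hd he; have hs := signed_perm_size hw.
rewrite -!(@nth_map int 0%R nat 0 absz) ?hs // => /eqP.
by rewrite nth_uniq ?size_map ?hs ?(signed_perm_uniq hw) // => /eqP.
Qed.

Lemma signed_perm_surj n w v :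
  signed_perm n w -> 0 < v <= n -> exists2 d, d < n & `|(w`_d)%R|%N = v.
Proof.
move=> hw hv; have hs := signed_perm_size hw.
have : v \in [seq `|z|%N | z <- w] by rewrite (perm_mem hw) mem_iota; lia.
move=> /(nthP 0) [d]; rewrite size_map hs => hd <-; exists d => //.
by rewrite (@nth_map int 0%R _ _) ?hs.
Qed.

Lemma signed_permI n w :
    size w = n -> (forall d, d < n -> 0 < `|(w`_d)%R|%N <= n) ->
    (forall d e, d < n -> e < n -> `|(w`_d)%R|%N = `|(w`_e)%R|%N -> d = e) ->
  signed_perm n w.
Proof.
move=> hs hr hi; have u : uniq [seq `|z|%N | z <- w].
  apply/(uniqP 0) => d e; rewrite !inE size_map hs => hd he.
  by rewrite !(@nth_map int 0%R _ _) ?hs //; apply: hi.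
apply: uniq_perm => //; first exact: iota_uniq.
have [] // := uniq_min_size u (s2 := iota 1 n); last by rewrite size_map size_iota hs.
move=> v /(nthP 0) [d]; rewrite size_map hs => hd <-.
by rewrite (@nth_map int 0%R _ _) ?hs // mem_iota; have := hr d hd; lia.
Qed.

(** The diagram has a dot in column d (from 0) and row |w_d|.  Column and row of
each dot are exchanged, the new rows are numbered downwards, and every sign is
changed. *)
Definition quarter_turn (w : seq int) : seq int :=
  mkseq (fun a => let d := index a.+1 [seq `|z|%N | z <- w] in
    if (w`_d < 0)%R then (size w - d)%:Z else - (size w - d)%:Z)%R (size w).

Lemma size_quarter_turn w : size (quarter_turn w) = size w.
Proof. by rewrite size_mkseq. Qed.

Lemma nth_quarter_turn n w d : signed_perm n w -> d < n ->
  ((quarter_turn w)`_(`|(w`_d)%R|%N.-1) =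
     if w`_d < 0 then (n - d)%N%:Z else - (n - d)%N%:Z)%R.
Proof.
move=> hw hd; have hs := signed_perm_size hw.
have hr := signed_perm_range hw hd.
rewrite nth_mkseq ?hs; last lia.
have -> : `|(w`_d)%R|%N.-1.+1 = `|(w`_d)%R|%N by lia.
suff -> : index `|(w`_d)%R|%N [seq `|z|%N | z <- w] = d by [].
rewrite -(@nth_map int 0%R nat 0 absz) ?hs //.
by rewrite index_uniq ?size_map ?hs ?(signed_perm_uniq hw).
Qed.

Lemma signed_perm_succ n w a : signed_perm n w -> a < n ->
  exists2 d, d < n & `|(w`_d)%R|%N = a.+1.
Proof. by move=> hw ha; apply: (signed_perm_surj hw); lia. Qed.

Lemma quarter_turn_signed_perm n w : signed_perm n w -> signed_perm n (quarter_turn w).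
Proof.
move=> hw; have hs := signed_perm_size hw.
apply: signed_permI => [|a ha|a b ha hb]; first by rewrite size_quarter_turn.
  have [d hd ea] := signed_perm_succ hw ha.
  have := nth_quarter_turn hw hd; rewrite ea /= => ->; case: ifP; lia.
have [d hd ea] := signed_perm_succ hw ha; have [e he eb] := signed_perm_succ hw hb.
have := nth_quarter_turn hw hd; have := nth_quarter_turn hw he; rewrite ea eb /= => -> -> h.
have ed : d = e by move: h; do 2 case: ifP; lia.
by move: eb; rewrite -ed ea => -[].
Qed.

Lemma quarter_turn_entry n w d a : signed_perm n w -> d < n -> `|(w`_d)%R|%N = a.+1 ->
  `|((quarter_turn w)`_a)%R|%N = n - d /\ ((quarter_turn w)`_a < 0)%R = ~~ (w`_d < 0)%R.
Proof.
move=> hw hd ea; have := nth_quarter_turn hw hd; rewrite ea /= => ->.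
by case: ifP; split; lia.
Qed.

(** The four turns of the diagram compose to the identity, and the four changes
of sign cancel. *)
Lemma quarter_turn4 n w : signed_perm n w ->
  quarter_turn (quarter_turn (quarter_turn (quarter_turn w))) = w.
Proof.
move=> h0; have hs := signed_perm_size h0.
have h1 := quarter_turn_signed_perm h0; have h2 := quarter_turn_signed_perm h1.
have h3 := quarter_turn_signed_perm h2.
apply: (@eq_from_nth int 0%R); rewrite !size_quarter_turn // hs => d hd.
have r0 := signed_perm_range h0 hd.
have [a ea] : exists a, `|(w`_d)%R|%N = a.+1 by exists `|(w`_d)%R|%N.-1; lia.
have [n1 s1] := quarter_turn_entry h0 hd ea.
have [||n2 s2] := @quarter_turn_entry n _ a (n - d.+1) h1; [lia|lia|].
have [||n3 s3] := @quarter_turn_entry n _ (n - d.+1) (n - a.+1) h2; [lia|lia|].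
have [||n4 s4] := @quarter_turn_entry n _ (n - a.+1) d h3; [lia|lia|].
by clear -n1 s1 n2 s2 n3 s3 n4 s4 ea r0; lia.
Qed.

Lemma containsP w s :
  reflect (exists2 f : nat -> nat, forall j, j < size s -> f j < size w &
     forall j k, j < size s -> k < size s ->
       [/\ j < k -> f j < f k,
           (`|(w`_(f j))%R|%N < `|(w`_(f k))%R|%N)%N = (`|(s`_j)%R|%N < `|(s`_k)%R|%N)%N
         & (w`_(f j) < 0)%R = (s`_j < 0)%R])
   (contains w s).
Proof.
apply: (iffP existsP) => [[i /forallP hi]|[f hf hi]].
  exists (fun j => if insub j is Some o then val (i o) else 0).
    by move=> j hj; rewrite insubT; apply: ltn_ord.
  move=> j k hj hk; rewrite !insubT /=.
  have /forallP/(_ (Sub k hk))/and3P[/implyP h1 /eqP h2 /eqP h3] := hi (Sub j hj).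
  by split => //; move: h2; rewrite -!abszE.
exists [ffun j : 'I_(size s) => Ordinal (hf j (ltn_ord j))].
apply/forallP => j; apply/forallP => k; rewrite !ffunE /=.
have [h1 h2 h3] := hi j k (ltn_ord j) (ltn_ord k).
by rewrite h3 eqxx andbT; apply/andP; split; [apply/implyP | rewrite -!abszE; apply/eqP].
Qed.

(** Turning both diagrams carries an occurrence along: the entry of the turned
pattern in position t comes from the entry of s of absolute value t + 1, and it
is found in the turned word at the position given by the value of its image. *)
Lemma contains_quarter_turn n m w s : signed_perm n w -> signed_perm m s ->
  contains w s -> contains (quarter_turn w) (quarter_turn s).
Proof.
move=> hw hs; have zw := signed_perm_size hw; have zs := signed_perm_size hs.
move=> /containsP [f hf hi]; rewrite zs zw in hf; rewrite zs in hi; apply/containsP.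
pose p t := index t.+1 [seq `|z|%N | z <- s].
have hp t : t < m -> p t < m /\ `|(s`_(p t))%R|%N = t.+1.
  move=> ht; have [d hd ed] := signed_perm_succ hs ht.
  suff -> : p t = d by [].
  rewrite /p -ed -(@nth_map int 0%R nat 0 absz) ?zs //.
  by rewrite index_uniq ?size_map ?zs ?(signed_perm_uniq hs).
(* p t is the position in s of the value t + 1. *)
exists (fun t => `|(w`_(f (p t)))%R|%N.-1); rewrite !size_quarter_turn ?zs ?zw.
  by move=> t /hp [ht _]; have := signed_perm_range hw (hf _ ht); lia.
move=> t t' /hp [ht et] /hp [ht' et'].
have [_ i2 i3] := hi _ _ ht ht'; have [_ _ i4] := hi _ _ ht' ht.
have r := signed_perm_range hw (hf _ ht); have r' := signed_perm_range hw (hf _ ht').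
have e := nth_quarter_turn hw (hf _ ht); have e' := nth_quarter_turn hw (hf _ ht').
have g := nth_quarter_turn hs ht; have g' := nth_quarter_turn hs ht'.
rewrite et /= in g; rewrite et' /= in g'.
have l1 : f (p t) < f (p t') = (p t < p t').
  have [[+ _ _] [+ _ _]] := (hi _ _ ht ht', hi _ _ ht' ht).
  case: (ltngtP (p t) (p t')) => [_ -> //|_ _ /(_ isT)|-> _ _]; lia.
have l2 : f (p t') < f (p t) = (p t' < p t).
  have [[+ _ _] [+ _ _]] := (hi _ _ ht ht', hi _ _ ht' ht).
  case: (ltngtP (p t) (p t')) => [_ /(_ isT)|_ _ -> //|-> _ _]; lia.
have q := hf _ ht; have q' := hf _ ht'.
rewrite e e' g g' i3 i4; split; first by rewrite et et' in i2; lia.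
- by do 2 case: ifP => _; lia.
- by case: ifP => _; lia.
Qed.

(** * Bruhat order on symmetric extensions *)

Lemma size_swap (u : seq int) i j (a b : int) :
  i < j < size u -> size (set_nth 0 (set_nth 0 u i a) j b)%R = size u.
Proof.
by move=> /andP[ij ju]; rewrite !size_set_nth !(maxn_idPr _) //; apply: ltn_trans ju.
Qed.

Lemma bruhat_step_swap (u v : seq int) i j :
    size v = size u -> i < j < size u -> (u`_i < u`_j)%R ->
    (v`_i = u`_j)%R -> (v`_j = u`_i)%R ->
    (forall k, k < size u -> k != i -> k != j -> (v`_k = u`_k)%R) ->
  bruhat_step u v.
Proof.
move=> hs hij hlt hi hj hk; exists i, j; split => //.
apply: (@eq_from_nth int 0%R) => [|k].
  by rewrite size_swap.
rewrite hs => lk; rewrite !nth_set_nth /=.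
case: eqP => [-> //|/eqP nj]; rewrite nth_set_nth /=.
by case: eqP => [-> //|/eqP ni]; apply: hk.
Qed.

Lemma nth_symmetric_cat n (w w' : seq int) k : size w = n ->
  ((rev [seq - z | z <- w] ++ w')`_k =
     if (k < n)%N then - w`_(n - k.+1) else w'`_(k - n))%R.
Proof.
move=> hs; rewrite nth_cat size_rev size_map hs.
by case: ltnP => // lk; rewrite nth_rev size_map hs // (@nth_map int 0%R _ _) // hs; lia.
Qed.

(** The right half of the extension and its mirror image are exchanged one after
the other; negation and reversal both turn the order around, so the mirror
transposition goes upwards as well. *)
Lemma bruhat_symmetric_swap n (w w' : seq int) p q :
    size w = n -> size w' = n -> p < q < n -> (w`_p < w`_q)%R ->
    (w'`_p = w`_q)%R -> (w'`_q = w`_p)%R ->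
    (forall k, k < n -> k != p -> k != q -> (w'`_k = w`_k)%R) ->
  bruhat_le (symmetric_ext w) (symmetric_ext w').
Proof.
move=> hw hw' hpq hlt hp hq hk.
pose m : seq int := rev [seq - z | z <- w]%R ++ w'.
have sz (z z' : seq int) : size z = n -> size z' = n ->
    size (rev [seq - x | x <- z]%R ++ z') = n + n.
  by move=> hz hz'; rewrite size_cat size_rev size_map hz hz'.
have e1 k : n + k < n = false by lia.
have e2 k : k < n -> n - k.+1 < n by lia.
have e3 k : k < n -> n - (n - k.+1).+1 = k by lia.
have [hpn hqn] : p < n /\ q < n by lia.
apply: (rt_trans _ _ _ m); apply: rt_step.
  apply: (@bruhat_step_swap _ _ (n + p) (n + q));
    rewrite ?sz // ?(nth_symmetric_cat _ _ hw) ?e1 ?addKn //; first lia.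
  move=> k lk kp kq; rewrite !(nth_symmetric_cat _ _ hw).
  by case: ltnP => // lk'; rewrite hk //; lia.
apply: (@bruhat_step_swap _ _ (n - q.+1) (n - p.+1));
  rewrite ?sz // ?(nth_symmetric_cat _ _ hw) ?(nth_symmetric_cat _ _ hw') ?e2 ?e3 //;
  [lia | by rewrite ltrN2 | by rewrite hq | by rewrite hp |].
move=> k lk kp kq; rewrite (nth_symmetric_cat _ _ hw) (nth_symmetric_cat _ _ hw').
by case: ltnP => // lk'; rewrite hk //; lia.
Qed.

(** The entries - w_p and w_p occupy mirror positions of the extension, so a
change of sign is a single transposition. *)
Lemma bruhat_symmetric_negate n (w w' : seq int) p :
    size w = n -> size w' = n -> p < n -> (0 < w`_p)%R -> (w'`_p = - w`_p)%R ->
    (forall k, k < n -> k != p -> (w'`_k = w`_k)%R) ->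
  bruhat_le (symmetric_ext w) (symmetric_ext w').
Proof.
move=> hw hw' hp h0 he hk; apply: rt_step.
have sz (z : seq int) : size z = n -> size (symmetric_ext z) = n + n.
  by move=> hz; rewrite size_cat size_rev size_map hz.
have e1 k : n + k < n = false by lia.
have e2 : n - p.+1 < n by lia.
have e3 : n - (n - p.+1).+1 = p by lia.
apply: (@bruhat_step_swap _ _ (n - p.+1) (n + p));
  rewrite ?sz // ?(nth_symmetric_cat _ _ hw) ?(nth_symmetric_cat _ _ hw')
    ?e1 ?e2 ?e3 ?addKn ?he ?opprK //; [lia | lia |].
move=> k lk k1 k2; rewrite (nth_symmetric_cat _ _ hw) (nth_symmetric_cat _ _ hw').
by case: ltnP => lk'; rewrite hk //; lia.
Qed.

Definition tail_count (w : seq int) (p : nat) (t : int) : nat :=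
  \sum_(k < size w | p <= k) (w`_k <= t)%R.

(** A step moves the smaller of two entries to the right; the count can only
change for a position p between the two, where it cannot drop. *)
Lemma bruhat_step_tail_count u v p t : bruhat_step u v ->
  tail_count u p t <= tail_count v p t.
Proof.
move=> [i [j [/andP[ij ju] lt0 ev]]]; have lt : (u`_i < u`_j)%R := lt0.
have sv : size v = size u.
  by rewrite ev size_swap ?ij.
have nv k : (v`_k = if k == j then u`_i else if k == i then u`_j else u`_k)%R.
  by rewrite ev nth_set_nth /=; case: ifP => // _; rewrite nth_set_nth.
pose oi := Ordinal (ltn_trans ij ju); pose oj := Ordinal ju.
have nji : oj != oi by rewrite -val_eqE /=; lia.
have split2 (F : 'I_(size u) -> nat) :
    \sum_k F k = F oi + (F oj + \sum_(k | (k != oi) && (k != oj)) F k).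
  by rewrite (bigD1 oi) // (bigD1 oj).
rewrite /tail_count sv [X in X <= _]big_mkcond [X in _ <= X]big_mkcond.
rewrite !split2 /= !nv !eqxx (ltn_eqF ij).
have -> : \sum_(k < size u | (k != oi) && (k != oj))
            (if p <= k then (v`_k <= t)%R : nat else 0)
        = \sum_(k < size u | (k != oi) && (k != oj))
            (if p <= k then (u`_k <= t)%R : nat else 0).
  by apply: eq_bigr => k /andP[]; rewrite -!val_eqE nv => /negbTE /= -> /negbTE ->.
rewrite !addnA leq_add2r.
by case: (leqP p i) => ?; case: (leqP p j) => ?; case: (lerP (u`_i)%R t) => ?;
  case: (lerP (u`_j)%R t) => ? //=; lia.
Qed.

Lemma bruhat_tail_count u v p t : bruhat_le u v ->
  size v = size u /\ tail_count u p t <= tail_count v p t.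
Proof.
elim=> {u v} [u v h|u|u w v _ [e1 l1] _ [e2 l2]] //.
- split; last exact: bruhat_step_tail_count.
  by case: h => [i [j [ij _ ->]]]; rewrite size_swap.
- by rewrite e2 e1; split => //; apply: leq_trans l2.
Qed.

(** [bruhat_low] and [bruhat_high] are the easy half of the tableau criterion:
a small entry far to the right survives on the way up, and a large one on the
way down. *)
Lemma bruhat_low (u v : seq int) p i (t : int) : bruhat_le u v ->
  p <= i < size u -> (u`_i <= t)%R -> exists2 j, p <= j < size v & (v`_j <= t)%R.
Proof.
move=> /(bruhat_tail_count p t)[sv le] hi ht.
have : 0 < tail_count v p t.
  apply: leq_trans le; rewrite /tail_count.
  by rewrite (bigD1 (Ordinal (proj2 (andP hi)))) /= ?ht //; lia.
rewrite lt0n sum_nat_eq0 => /forallPn [j]; rewrite negb_imply => /andP[pj nj].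
by exists j; [rewrite pj ltn_ord | lia].
Qed.

Lemma bruhat_high (u v : seq int) p i (t : int) : bruhat_le u v ->
  p <= i < size v -> (t <= v`_i)%R -> exists2 j, p <= j < size u & (t <= u`_j)%R.
Proof.
move=> /(bruhat_tail_count p (t - 1)%R)[sv le] hi ht.
(* Counting the entries at least t amounts to not counting those at most t - 1. *)
pose c (w : seq int) := \sum_(k < size w | p <= k) (t <= w`_k)%R.
have cE w : c w + tail_count w p (t - 1)%R = \sum_(k < size w | p <= k) 1.
  by rewrite /c -big_split; apply: eq_bigr => k _ /=; lia.
have : 0 < c u.
  have [e1 e2] := (cE u, cE v); rewrite sv in e2.
  have : 0 < c v; last lia.
  by rewrite /c (bigD1 (Ordinal (proj2 (andP hi)))) /= ?ht //; lia.
rewrite lt0n sum_nat_eq0 => /forallPn [j]; rewrite negb_imply => /andP[pj nj].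
by exists j; [rewrite pj ltn_ord | lia].
Qed.

(** * Profiles and the words they encode *)

(** The number of up steps of |P| before its d-th down step, when s is the
profile of P: that step starts at height |s d|, after d down steps. *)
Definition reach (s : nat -> int) (d : nat) : nat := `|s d|%N + d.

(** The profiles of Grand-Dyck paths.  Between two consecutive down steps of |P|
there are only up steps, and a change of side happens on the axis, after a down
step that starts at height 1. *)
Definition admissible (n : nat) (s : nat -> int) : Prop :=
  forall d, d < n ->
    [/\ s d != 0%R, reach s d <= n,
        d.+1 < n -> reach s d <= reach s d.+1
      & d.+1 < n -> (s d < 0)%R != (s d.+1 < 0)%R -> `|s d|%N = 1].

(** The stack discipline: the label popped at time d is available, and every
larger label available at that time has been popped before. *)
Definition encodes (n : nat) (s : nat -> int) (w : seq int) : Prop :=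
  signed_perm n w /\
  forall d, d < n ->
    [/\ `|(w`_d)%R|%N <= reach s d, (w`_d < 0)%R = (s d < 0)%R
      & forall e, e < n -> `|(w`_d)%R|%N < `|(w`_e)%R|%N <= reach s d -> e < d].

Lemma leq_reach n s d e : admissible n s -> d <= e < n -> reach s d <= reach s e.
Proof.
move=> hs; elim: e => [|e IH] h; first by have -> : d = 0 by lia.
case: (eqVneq d e.+1) => [-> //|ne]; apply: leq_trans (IH _) _; first lia.
by have [|_ _ h1 _] := hs e; [lia | apply: h1; lia].
Qed.

(** A prefix of length t + 1 with absolute values at most t + 1 uses up all of
them. *)
Lemma prefix_pigeonhole n w t e : signed_perm n w -> t < e < n ->
  (forall i, i <= t -> `|(w`_i)%R|%N <= t.+1) -> t.+1 < `|(w`_e)%R|%N.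
Proof.
move=> hw he hi; rewrite ltnNge; apply/negP => le.
have /uniq_leq_size : uniq [seq `|(w`_i)%R|%N | i <- e :: iota 0 t.+1].
  rewrite map_inj_in_uniq; first by rewrite cons_uniq mem_iota iota_uniq; lia.
  move=> i j; rewrite !inE !mem_iota => hi' hj; apply: (signed_perm_inj hw); lia.
move=> /(_ (iota 1 t.+1)); rewrite size_map /= !size_iota.
suff h v : v \in [seq `|(w`_i)%R|%N | i <- e :: iota 0 t.+1] -> v \in iota 1 t.+1.
  by move=> /(_ h); rewrite ltnn.
move=> /mapP [i]; rewrite inE !mem_iota => hi' ->.
have hin : i < n by case/predU1P: hi' => [->|]; lia.
have := signed_perm_range hw hin; case/predU1P: hi' => [->|hi']; first lia.
by have := hi i; lia.
Qed.

Lemma suffix_pigeonhole n w d m : signed_perm n w -> d < m <= n ->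
  exists2 r, d <= r < n & `|(w`_r)%R|%N <= m.
Proof.
move=> hw hm; case: (boolP [exists r : 'I_n, (d <= r) && (`|(w`_r)%R|%N <= m)]).
  by move=> /existsP [r /andP[r1 r2]]; exists r; rewrite ?r1 ?ltn_ord.
move=> /existsPn no; exfalso.
have hsub v : v \in iota 1 m -> v \in [seq `|(w`_i)%R|%N | i <- iota 0 d].
  rewrite mem_iota => hv; have [|i hi ei] := signed_perm_surj hw (v := v); first lia.
  rewrite -ei; apply: (map_f (fun i => `|(w`_i)%R|%N)); rewrite mem_iota.
  by have := no (Ordinal hi); rewrite negb_and /= ei; lia.
have := uniq_leq_size (iota_uniq 1 m) hsub.
by rewrite size_map !size_iota; lia.
Qed.

(** The largest label pushed before time d is popped at once or was popped
earlier. *)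
Lemma encodes_reach n s w d : admissible n s -> encodes n s w -> d < n ->
  exists2 e, e <= d & `|(w`_e)%R|%N = reach s d.
Proof.
move=> hs [hw hg] hd; have [g1 _ g2] := hg d hd; have [a1 a2 _ _] := hs d hd.
have [|e he ee] := signed_perm_surj hw (v := reach s d); first by rewrite /reach in a2 *; lia.
case: (eqVneq `|(w`_d)%R|%N (reach s d)) => [|ne]; first by exists d.
exists e => //; apply: ltnW; apply: (g2 e he); lia.
Qed.

Lemma sign_change n s d : admissible n s -> d.+1 < n ->
  (s d < 0)%R != (s d.+1 < 0)%R -> reach s d = d.+1.
Proof. by move=> hs hd h; have [|_ _ _ /(_ hd h)] := hs d; rewrite /reach; lia. Qed.

Lemma same_sign n s d e : admissible n s -> d <= e < n ->
  (forall t, d <= t < e -> reach s t != t.+1) -> (s d < 0)%R = (s e < 0)%R.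
Proof.
move=> hs; elim: e => [|e IH] he ht; first by have -> : d = 0 by lia.
case: (eqVneq d e.+1) => [-> //|ne].
rewrite IH; [|lia|by move=> t h; apply: ht; lia].
apply/eqP/negP => /negP h; have := ht e.
by rewrite (sign_change hs _ h) ?eqxx; [lia | lia].
Qed.

Lemma same_sign_reach n s d e : admissible n s -> d <= e < n -> e < reach s d ->
  (s d < 0)%R = (s e < 0)%R.
Proof.
move=> hs he hr; apply: (same_sign hs) => // t ht.
by have := leq_reach hs (d := d) (e := t); lia.
Qed.

(** If the sign changed at some time t with d <= t < e, the stack would be empty
after time t, whereas the label popped at time e was pushed before time d. *)
Lemma same_sign_encodes n s w d e : admissible n s -> encodes n s w ->
  d <= e < n -> `|(w`_e)%R|%N <= reach s d -> (s d < 0)%R = (s e < 0)%R.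
Proof.
move=> hs [hw hg] he hr; apply: (same_sign hs) => // t ht; apply/eqP => ht1.
have := @prefix_pigeonhole n w t e hw; rewrite -ht1 => hp.
have : reach s t < `|(w`_e)%R|%N.
  apply: hp => [|i hi]; first lia; have [|g1 _ _] := hg i; first lia.
  by apply: leq_trans g1 _; apply: (leq_reach hs); lia.
by have := leq_reach hs (d := d) (e := t); lia.
Qed.

(** Where two encoded words first differ, the larger of the two labels is already
available in the word that pops the smaller one, so it was popped there before,
and hence also in the other word. *)
Lemma encodes_inj n s w w' : admissible n s -> encodes n s w -> encodes n s w' -> w = w'.
Proof.
move=> hs [hw hg] [hw' hg'].
have zw := signed_perm_size hw; have zw' := signed_perm_size hw'.
apply: (@eq_from_nth int 0%R); rewrite ?zw' // zw.
move=> d; elim/ltn_ind: d => d IH hd; have [g1 g2 g3] := hg d hd; have [h1 h2 h3] := hg' d hd.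
have r := signed_perm_range hw hd; have r' := signed_perm_range hw' hd.
suff : `|(w`_d)%R|%N = `|(w'`_d)%R|%N by lia.
case: (ltngtP `|(w`_d)%R|%N `|(w'`_d)%R|%N) => // l.
  have [e he ee] := signed_perm_surj hw r'.
  have ed : e < d by apply: (g3 e he); lia.
  have := @signed_perm_inj n w' e d hw' he hd.
  by rewrite -IH // => /(_ ee); lia.
have [e he ee] := signed_perm_surj hw' r.
have ed : e < d by apply: (h3 e he); lia.
have := @signed_perm_inj n w e d hw he hd.
by rewrite IH // => /(_ ee); lia.
Qed.

Definition swap_entries (w : seq int) d e : seq int :=
  mkseq (fun t => if t == d then w`_e else if t == e then w`_d else w`_t)%R (size w).

Lemma nth_swap_entries n w d e t : signed_perm n w -> t < n ->
  ((swap_entries w d e)`_t = if t == d then w`_e else if t == e then w`_d else w`_t)%R.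
Proof. by move=> hw ht; rewrite nth_mkseq // (signed_perm_size hw). Qed.

Lemma signed_perm_swap n w d e : signed_perm n w -> d < n -> e < n ->
  signed_perm n (swap_entries w d e).
Proof.
move=> hw hd he; apply: signed_permI => [|i hi|i j hi hj].
- by rewrite size_mkseq (signed_perm_size hw).
- by rewrite (nth_swap_entries _ _ hw hi); case: ifP => _; last case: ifP => _;
  apply: (signed_perm_range hw).
rewrite (nth_swap_entries _ _ hw hi) (nth_swap_entries _ _ hw hj).
by case: (eqVneq i d) => ?; case: (eqVneq i e) => ?; case: (eqVneq j d) => ?;
  case: (eqVneq j e) => ?; move=> h; have := signed_perm_inj hw _ _ h; lia.
Qed.

(** Absolute values become positions under the quarter turn, and positive entries
become negative.  Hence exchanging two entries of equal sign moves the turned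
word up when the first is smaller in absolute value and the sign is positive,
and also when it is larger and the sign is negative. *)
Lemma bruhat_swap_entries n w d e : signed_perm n w -> d < e < n ->
    (w`_d < 0)%R = (w`_e < 0)%R ->
    (`|(w`_d)%R|%N < `|(w`_e)%R|%N) = (0 < w`_d)%R ->
  bruhat_le (symmetric_ext (quarter_turn w)) (symmetric_ext (quarter_turn (swap_entries w d e))).
Proof.
move=> hw hde sg lt; have [hd he] : d < n /\ e < n by lia.
have zw := signed_perm_size hw.
pose w' := swap_entries w d e; have hw' : signed_perm n w' by apply: signed_perm_swap.
have w'E t (ht : t < n) := nth_swap_entries d e hw ht; rewrite -/w' in w'E.
have rd := signed_perm_range hw hd; have re := signed_perm_range hw he.
have nd := nth_quarter_turn hw hd; have ne := nth_quarter_turn hw he.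
have nd' := nth_quarter_turn hw' hd; have ne' := nth_quarter_turn hw' he.
have ned : (e == d) = false by lia.
rewrite !w'E // eqxx in nd'; rewrite !w'E // eqxx ned in ne'.
have dif : `|(w`_d)%R|%N != `|(w`_e)%R|%N.
  by apply/eqP => /(signed_perm_inj hw hd he); lia.
have other k : k < n -> k != `|(w`_d)%R|%N.-1 -> k != `|(w`_e)%R|%N.-1 ->
    ((quarter_turn w')`_k = (quarter_turn w)`_k)%R.
  move=> hk kd ke; have [t ht et] := signed_perm_succ hw hk.
  have td : t <> d by move=> td; move: kd; rewrite -td et eqxx.
  have te : t <> e by move=> te; move: ke; rewrite -te et eqxx.
  have := nth_quarter_turn hw ht; have := nth_quarter_turn hw' ht.
  by rewrite w'E //; case: eqP => // _; case: eqP => // _; rewrite et /= => -> ->.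
have zr : size (quarter_turn w) = n by rewrite size_quarter_turn.
have zr' : size (quarter_turn w') = n by rewrite size_quarter_turn (signed_perm_size hw').
case: (ltrP (w`_d)%R 0%R) => w0.
  apply: (@bruhat_symmetric_swap n _ _ `|(w`_e)%R|%N.-1 `|(w`_d)%R|%N.-1) => //; first lia.
  - by rewrite nd ne -sg w0; lia.
  - by rewrite nd nd' sg.
  - by rewrite ne ne' sg.
  - by move=> k hk k1 k2; apply: other.
apply: (@bruhat_symmetric_swap n _ _ `|(w`_d)%R|%N.-1 `|(w`_e)%R|%N.-1) => //; first lia.
- by rewrite nd ne -sg (le_gtF w0); lia.
- by rewrite ne' ne -sg.
- by rewrite nd' nd -sg.
Qed.

(** * Moving one term of a profile *)

(** Raising |s d| pushes the label [reach s d] + 1 just before the d-th pop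
instead of just after it.  It is then popped at time d, and the label formerly
popped at time d takes over its later place. *)
Lemma encodes_raise n s s' w d : admissible n s -> admissible n s' ->
    encodes n s w -> d < n -> (forall t, t != d -> s' t = s t) ->
    (s' d < 0)%R = (s d < 0)%R -> `|s' d|%N = `|s d|%N.+1 ->
  exists2 e, d < e < n & [/\ (w`_d < 0)%R = (w`_e < 0)%R,
    `|(w`_d)%R|%N < `|(w`_e)%R|%N & encodes n s' (swap_entries w d e)].
Proof.
move=> hs hs' hw hd ht sg ab; have [pw hg] := hw.
have r' : reach s' d = (reach s d).+1 by rewrite /reach ab.
have [_ an an1 _] := hs' d hd; rewrite r' in an an1.
(* e is the time at which the newly available label used to be popped. *)
have [e he ee] := signed_perm_surj pw (v := (reach s d).+1) an.
have de : d < e.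
  rewrite ltnNge; apply/negP => le; have [g1 _ _] := hg e he.
  by have := leq_reach hs (d := e) (e := d); lia.
have d1 : d.+1 < n by lia.
have rd1 : reach s d < reach s d.+1.
  by have := an1 d1; rewrite /reach (ht d.+1) //; lia.
have [g1 g2 g3] := hg d hd; have [h1 h2 h3] := hg e he.
have lde : `|(w`_d)%R|%N < `|(w`_e)%R|%N by lia.
have sde : (s d < 0)%R = (s e < 0)%R.
  have := same_sign_encodes hs hw (d := d.+1) (e := e); rewrite ee => <- //; last lia.
  have [_ _ _ /(_ d1)] := hs' d hd; rewrite sg (ht d.+1); last lia.
  by have [az _ _ _] := hs d hd; case: eqP => // _; lia.
exists e; first lia; split => //; first by rewrite g2 h2.
split; first exact: signed_perm_swap.
have re : reach s' e = reach s e by rewrite /reach ht //; lia.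
have red := leq_reach hs (d := d) (e := e).
move=> t lt; rewrite (nth_swap_entries d e pw lt).
case: (eqVneq t d) => [->|td].
  by split; [lia | by rewrite sg h2 | move=> q _; lia].
have rt : reach s' t = reach s t by rewrite /reach ht.
rewrite rt (ht t td); case: (eqVneq t e) => [->|te].
  split; [lia | by rewrite g2 |].
  move=> q hq; rewrite (nth_swap_entries d e pw hq).
  case: (eqVneq q d) => [-> _ //|qd]; case: (eqVneq q e) => [-> |qe]; first lia.
  move=> hl; have [l|l] := leqP `|(w`_q)%R|%N (reach s d).
    by have := g3 q hq; lia.
  have /eqP ne : `|(w`_q)%R|%N <> `|(w`_e)%R|%N.
    by move=> /(signed_perm_inj pw hq he); lia.
  by apply: (h3 q hq); lia.
have [k1 k2 k3] := hg t lt; split => // q hq; rewrite (nth_swap_entries d e pw hq).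
case: (eqVneq q d) => [->|qd]; first by have := k3 e he; lia.
case: (eqVneq q e) => [->|qe] hl; last by apply: k3.
have dt := k3 d hd hl; rewrite ltnNge; apply/negP => le.
by have := k3 e he; have := leq_reach hs (d := d.+1) (e := t); lia.
Qed.

(** The reverse move makes the label [reach s d], which was pushed just before
the d-th pop, unavailable at time d; the next largest label on the stack is
popped instead. *)
Lemma encodes_lower n s s' w d : admissible n s -> admissible n s' ->
    encodes n s w -> d < n -> (forall t, t != d -> s' t = s t) ->
    (s' d < 0)%R = (s d < 0)%R -> `|s d|%N = `|s' d|%N.+1 ->
  exists2 e, d < e < n & [/\ (w`_d < 0)%R = (w`_e < 0)%R,
    `|(w`_e)%R|%N < `|(w`_d)%R|%N & encodes n s' (swap_entries w d e)].
Proof.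
move=> hs hs' hw hd ht sg ab; have [pw hg] := hw.
have r' : reach s d = (reach s' d).+1 by rewrite /reach ab.
have [nz' _ _ _] := hs' d hd; have [_ an _ an2] := hs d hd.
(* Some label other than [reach s d] is on the stack at time d, because |s d| > 1;
   e is the time at which the largest of these is popped. *)
have [r hr lr] := suffix_pigeonhole (d := d) (m := reach s' d) pw ltac:(rewrite /reach in an r' *; lia).
pose P (i : 'I_n) := (d <= i) && (`|(w`_i)%R|%N <= reach s' d).
have hr' : r < n by lia.
have P0 : P (Ordinal hr') by rewrite /P /= lr andbT; lia.
case: (@arg_maxnP _ _ P (fun i => `|(w`_i)%R|%N) P0) => -[e he] /= /andP[/= de le] mx.
have {P P0 mx} mx q : q < n -> d <= q -> `|(w`_q)%R|%N <= reach s' d ->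
    `|(w`_q)%R|%N <= `|(w`_e)%R|%N.
  by move=> hq dq lq; apply: (mx (Ordinal hq)); rewrite /P /= dq.
have wd : `|(w`_d)%R|%N = reach s d.
  have [q qd wq] := encodes_reach hs hw hd.
  case: (eqVneq q d) => [qe|qn]; first by rewrite -{1}qe.
  have qd' : q < d by rewrite ltn_neqAle qn.
  have [g1 _ _] := hg q (ltn_trans qd' hd).
  have := leq_reach hs' (d := q) (e := d); rewrite {1}/reach ht // -/(reach s q); lia.
have ned : d != e by apply/eqP => ed; move: le; rewrite -ed wd r' ltnn.
have [g1 g2 g3] := hg d hd; have [h1 h2 h3] := hg e he.
have sde : (s d < 0)%R = (s e < 0)%R.
  by apply: (same_sign_encodes hs hw); lia.
exists e; first lia; split; [by rewrite g2 h2 | lia | split; first exact: signed_perm_swap].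
have re : reach s' e = reach s e by rewrite /reach ht // eq_sym.
have red := leq_reach hs (d := d) (e := e).
have gap q : q < n -> `|(w`_e)%R|%N < `|(w`_q)%R|%N < `|(w`_d)%R|%N -> q < d.
  move=> hq hl; rewrite ltnNge; apply/negP => dq.
  by have := mx q hq dq; lia.
move=> t lt; rewrite (nth_swap_entries d e pw lt).
case: (eqVneq t d) => [->|td].
  split; [lia | by rewrite sg h2 |].
  move=> q hq; rewrite (nth_swap_entries d e pw hq).
  case: (eqVneq q d) => [->|qd]; first lia.
  by case: (eqVneq q e) => [->|qe] hl; [lia | apply: gap hq _; lia].
have rt : reach s' t = reach s t by rewrite /reach ht.
rewrite rt (ht t td); case: (eqVneq t e) => [->|te].
  split; [lia | by rewrite g2 |].
  move=> q hq; rewrite (nth_swap_entries d e pw hq).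
  case: (eqVneq q d) => [-> _|qd]; first lia.
  by case: (eqVneq q e) => [->|qe] hl; [lia | apply: (h3 q hq); lia].
have [k1 k2 k3] := hg t lt; split => // q hq; rewrite (nth_swap_entries d e pw hq).
case: (eqVneq q d) => [->|qd] hl.
  by apply: ltn_trans (k3 e he hl); lia.
case: (eqVneq q e) hl => [->|qe] hl; last by apply: k3.
have dt := k3 d hd hl; rewrite ltnNge; apply/negP => lte.
have /eqP ne : `|(w`_t)%R|%N <> `|(w`_e)%R|%N.
  by move=> /(signed_perm_inj pw lt he); lia.
have := gap t lt; have := k3 e he; lia.
Qed.

(** Moving a term from -1 to 1 reflects a single peak in the axis.  This leaves
|P|, and hence the popped labels, unchanged. *)
Lemma encodes_negate n s s' w d : admissible n s ->
    encodes n s w -> d < n -> (forall t, t != d -> s' t = s t) ->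
    s d = (- 1)%R -> s' d = 1%R ->
  exists2 w', encodes n s' w' &
    bruhat_le (symmetric_ext (quarter_turn w)) (symmetric_ext (quarter_turn w')).
Proof.
move=> hs [pw hg] hd ht e1 e2; have zw := signed_perm_size pw.
pose w' := mkseq (fun t => if t == d then - w`_t else w`_t)%R n.
have w'E t : t < n -> (w'`_t = if t == d then - w`_t else w`_t)%R.
  by move=> lt; rewrite nth_mkseq.
have aw' t : t < n -> `|(w'`_t)%R|%N = `|(w`_t)%R|%N.
  by move=> lt; rewrite w'E //; case: ifP; lia.
have pw' : signed_perm n w'.
  apply: signed_permI => [|t lt|t q lt lq]; first by rewrite size_mkseq.
    by rewrite aw' //; apply: (signed_perm_range pw).
  by rewrite !aw' //; apply: signed_perm_inj pw _ _.
have wd := signed_perm_range pw hd; have [_ wd0 _] := hg d hd.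
have wneg : (w`_d < 0)%R by rewrite wd0 e1.
exists w'.
  split=> // t lt; have [g1 g2 g3] := hg t lt.
  have rt : reach s' t = reach s t.
    by rewrite /reach; case: (eqVneq t d) => [->|td]; [rewrite e1 e2 | rewrite ht].
  rewrite rt aw' //; split => // [|q lq].
    by rewrite w'E //; case: eqVneq => [->|td]; [rewrite e2; lia | rewrite ht].
  by rewrite aw' //; apply: g3.
have nd := nth_quarter_turn pw hd; rewrite wneg in nd.
have nd' := nth_quarter_turn pw' hd; rewrite aw' // w'E // eqxx in nd'.
have wpos : (- w`_d < 0)%R = false by lia.
rewrite wpos in nd'.
apply: (@bruhat_symmetric_negate n _ _ `|(w`_d)%R|%N.-1).
- by rewrite size_quarter_turn.
- by rewrite size_quarter_turn size_mkseq.
- lia.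
- by rewrite nd; lia.
- by rewrite nd nd'.
move=> k hk kd; have [t lt et] := signed_perm_succ pw hk.
have td : t <> d by move=> td; move: kd; rewrite -td et eqxx.
have := nth_quarter_turn pw lt; have := nth_quarter_turn pw' lt.
by rewrite aw' // w'E //; case: eqP => // _; rewrite et /= => -> ->.
Qed.

(** * Bruhat order and termwise order of profiles *)

Definition update (s : nat -> int) (d : nat) (v : int) : nat -> int :=
  fun t => if t == d then v else s t.

Lemma admissible_update n s d v : admissible n s -> d < n -> v != 0%R ->
    `|v|%N + d <= n ->
    (0 < d -> [/\ reach s d.-1 <= `|v|%N + d &
       (s d.-1 < 0)%R != (v < 0)%R -> `|s d.-1|%N = 1]) ->
    (d.+1 < n -> [/\ `|v|%N + d <= reach s d.+1 &
       (v < 0)%R != (s d.+1 < 0)%R -> `|v|%N = 1]) ->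
  admissible n (update s d v).
Proof.
move=> hs hd v0 vn hl hr t lt; have [h1 h2 h3 h4] := hs t lt.
rewrite /reach /update; case: (eqVneq t d) => [->|td].
  have -> : (d.+1 == d) = false by lia.
  by split => // /hr [].
case: (eqVneq t.+1 d) => [td1|td1]; last by split.
have [|l1 l2] := hl; first by rewrite -td1.
rewrite -td1 /= in l1 l2 *; split => // _; exact: l2.
Qed.

(** A negative term that still has to grow is raised first: the least such index
works, since a negative predecessor already agrees with s'.  If there is none,
all terms that differ are positive, and the last of them can be raised, since its
successor already agrees with s'.  The value 0 is skipped. *)
Lemma update_toward n s s' : admissible n s -> admissible n s' ->
    (forall d, d < n -> (s d <= s' d)%R) -> (exists2 d, d < n & s d != s' d) ->
  exists2 d, d < n & exists2 v, (s d < v <= s' d)%R &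
    admissible n (update s d v) /\ (v = s d + 1 \/ s d = - 1 /\ v = 1)%R.
Proof.
move=> hs hs' le [d0 hd0 ne0].
pose neg d := [&& d < n, (s d < 0)%R & (s d < s' d)%R].
case: (boolP (has neg (iota 0 n))) => [/hasP [d1 _ n1]|noneg].
  have ex : exists d, neg d by exists d1.
  case: (ex_minnP ex) => d /and3P[hd sd sd'] mn; exists d => //.
  have [az an am sg] := hs d hd; have [az' an' am' sg'] := hs' d hd.
  have [v hv] : exists v, (s d = - 1 /\ v = 1 \/ s d < - 1 /\ v = s d + 1)%R.
    by case: (eqVneq (s d) (- 1)%R) => ?; [exists 1%R | exists (s d + 1)%R]; lia.
  exists v; first lia.
  split; last by case: hv => -[? ?]; [right | left].
  have vd : `|v|%N + d <= reach s d by rewrite /reach; lia.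
  apply: admissible_update => //; [lia | exact: leq_trans vd an | |].
    move=> d0'; have hd' : d.-1 < n by lia.
    have := mn d.-1; have := le _ hd'; rewrite /neg hd' /= => le1 mn1.
    have [bz bn bm bg] := hs _ hd'; have [bz' bn' bm' bg'] := hs' _ hd'.
    rewrite /reach prednK // in bm bg bm' bg' *.
    by split; lia.
  move=> d1n; split; first exact: leq_trans vd (am d1n).
  by lia.
have pos d : d < n -> s d != s' d -> (0 < s d)%R.
  move=> hd ne; have [az _ _ _] := hs d hd; have le1 := le d hd.
  have : ~~ neg d by apply: (hasPn noneg); rewrite mem_iota.
  by rewrite /neg hd /=; lia.
have ex : exists d, (d < n) && (s d != s' d) by exists d0; rewrite hd0.
have ub d : (d < n) && (s d != s' d) -> d <= n by lia.
case: (ex_maxnP ex ub) => d /andP[hd ne] mx; exists d => //.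
have sd := pos d hd ne; have le1 := le d hd.
have [az an am sg] := hs d hd; have [az' an' am' sg'] := hs' d hd.
exists (s d + 1)%R; first lia.
split; last by left.
rewrite /reach in an am an' am'.
apply: admissible_update => //; [lia | lia | |].
  move=> d0'; have hd' : d.-1 < n by lia.
  by have [_ _ bm bg] := hs _ hd'; rewrite prednK // /reach in bm bg *; split; lia.
move=> d1n; have eq1 : s d.+1 = s' d.+1.
  by apply/eqP/negPn/negP => n1; have := mx d.+1; rewrite d1n n1 => /(_ isT); lia.
have [bz bn _ _] := hs _ d1n; rewrite eq1 /reach in am bz bn *.
by split; lia.
Qed.

(** Induction on the distance between the two profiles: each move towards s'
turns into upward transpositions, and equal profiles encode equal words. *)
Lemma bruhat_of_leq n s s' w w' : admissible n s -> admissible n s' ->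
    encodes n s w -> encodes n s' w' -> (forall d, d < n -> (s d <= s' d)%R) ->
  bruhat_le (symmetric_ext (quarter_turn w)) (symmetric_ext (quarter_turn w')).
Proof.
have [N] := ubnP (\sum_(d < n) `|(s' d - s d)%R|%N).
elim: N s w => // N IH s w hN hs hs' hw hw' le.
case: (boolP (all (fun d => s d == s' d) (iota 0 n))) => [/allP same|].
  have es d : d < n -> s d = s' d by move=> hd; apply/eqP/same; rewrite mem_iota.
  suff -> : w = w' by apply: rt_refl.
  apply: (encodes_inj hs') => //; case: hw => pw hg; split=> // d hd.
  by have := hg d hd; rewrite /reach es.
move=> /allPn [d0]; rewrite mem_iota => hd0 ne0.
have [|d hd [v hv [hu hc]]] := update_toward hs hs' le; first by exists d0.
have ut t : t != d -> update s d v t = s t by rewrite /update => /negbTE ->.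
have ud : update s d v d = v by rewrite /update eqxx.
have [az _ _ _] := hs d hd; have [vz _ _ _] := hu d hd; rewrite ud in vz.
suff [w1 hw1 b1] : exists2 w1, encodes n (update s d v) w1 &
    bruhat_le (symmetric_ext (quarter_turn w)) (symmetric_ext (quarter_turn w1)).
  apply: (rt_trans _ _ _ _ _ b1); apply: (IH (update s d v)) => //; last first.
    by move=> t lt; rewrite /update; case: eqP => [->|_]; [lia | apply: le].
  rewrite ltnS in hN; apply: leq_trans hN;
    rewrite (bigD1 (Ordinal hd)) // [X in _ <= X](bigD1 (Ordinal hd)) //=.
  rewrite ud [X in (_ + X) < _](eq_bigr (fun t : 'I_n => `|(s' t - s t)%R|%N)).
    by rewrite ltn_add2r; lia.
  by move=> t; rewrite -val_eqE /= => td; rewrite ut.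
have [pw hg] := hw; have [_ wd _] := hg d hd; have wr := signed_perm_range pw hd.
case: hc => [ev|[sd ev]]; last by apply: (encodes_negate hs hw hd ut); rewrite ?ud.
case: (ltrP 0%R (s d)) => s0.
  have [||e hde [sg lt hw1]] := encodes_raise hs hu hw hd ut; rewrite ?ud; [lia..|].
  exists (swap_entries w d e) => //; apply: bruhat_swap_entries pw hde sg _.
  by rewrite lt; lia.
have [||e hde [sg lt hw1]] := encodes_lower hs hu hw hd ut; rewrite ?ud; [lia..|].
exists (swap_entries w d e) => //; apply: bruhat_swap_entries pw hde sg _.
by lia.
Qed.

(** An absolute value above d within the first d + 1 entries is not larger than
the reach at d, and the path cannot meet the axis in between. *)
Lemma reach_of_entry n s w q d m : admissible n s -> encodes n s w ->
    q <= d < n -> d < m <= `|(w`_q)%R|%N ->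
  m <= reach s d /\ (s d < 0)%R = (w`_q < 0)%R.
Proof.
move=> hs [pw hg] hq hm; have [|g1 g2 _] := hg q; first lia.
have := leq_reach hs (d := q) (e := d); split; first lia.
by rewrite g2 (same_sign_reach hs (d := q) (e := d)); lia.
Qed.

(** If s' d < s d, then s d > 0 or s' d < 0.  In the first case the positive entry
[reach s d] of w turns into an entry at most - (n - d) from position
[reach s d] - 1 on; by [bruhat_low] the turned w' has such an entry too, so w' has
a positive entry at least [reach s d] within its first d + 1 entries, which forces
s' d >= s d.  The second case exchanges the two words and the signs. *)
Lemma leq_of_bruhat n s s' w w' : admissible n s -> admissible n s' ->
    encodes n s w -> encodes n s' w' ->
    bruhat_le (symmetric_ext (quarter_turn w)) (symmetric_ext (quarter_turn w')) ->
  forall d, d < n -> (s d <= s' d)%R.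
Proof.
move=> hs hs' hw hw' hb d hd; rewrite leNgt; apply/negP => lt.
have [pw hg] := hw; have [pw' hg'] := hw'.
have zw := signed_perm_size pw; have zw' := signed_perm_size pw'.
have zr : size (symmetric_ext (quarter_turn w)) = n + n.
  by rewrite size_cat size_rev size_map size_quarter_turn zw.
have zr' : size (symmetric_ext (quarter_turn w')) = n + n.
  by rewrite size_cat size_rev size_map size_quarter_turn zw'.
have nr (x : seq int) k : size x = n -> k < n -> ((symmetric_ext x)`_(n + k) = x`_k)%R.
  by move=> zx hk; rewrite (nth_symmetric_cat _ _ zx) addKn; case: ltnP => //; lia.
have rd d1 (s1 : nat -> int) : admissible n s1 -> d1 < n -> d1 < reach s1 d1 <= n.
  by move=> h1 /h1 []; rewrite /reach; lia.
have nr_sub k : n <= k < n + n -> n + (k - n) = k /\ k - n < n by lia.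
case: (ltrP 0%R (s d)) => s0.
  have [e ed we] := encodes_reach hs hw hd; have en : e < n by lia.
  have rs := rd _ _ hs hd.
  have se : (w`_e < 0)%R = false.
    by have [||_ <-] := reach_of_entry (m := reach s d) hs hw (q := e) (d := d); lia.
  have ne := nth_quarter_turn pw en; rewrite we se in ne.
  have kn : (reach s d).-1 < n by lia.
  have [||j hj nj] := bruhat_low (p := n + (reach s d).-1)
      (i := n + (reach s d).-1) (t := (- (n - d)%N%:Z)%R) hb;
        rewrite ?nr ?ne ?size_quarter_turn //; [lia|lia|].
  rewrite zr' in hj; have [jE jn] := nr_sub j ltac:(lia).
  rewrite -jE nr ?size_quarter_turn // in nj.
  have [q hq wq] := signed_perm_succ pw' jn; have := nth_quarter_turn pw' hq.
  rewrite wq /= => nq; rewrite nq in nj.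
  have wq0 : (w'`_q < 0)%R = false by case: ifP nj => //; lia.
  rewrite wq0 in nj.
  have [||r1 r2] := reach_of_entry (m := reach s d) hs' hw' (q := q) (d := d); [lia|lia|].
  by rewrite wq0 /reach in r1 r2 *; lia.
have [e ed we] := encodes_reach hs' hw' hd; have en : e < n by lia.
have rs := rd _ _ hs' hd; have [z _ _ _] := hs d hd.
have se : (w'`_e < 0)%R.
  by have [||_ <-] := reach_of_entry (m := reach s' d) hs' hw' (q := e) (d := d); lia.
have ne := nth_quarter_turn pw' en; rewrite we se in ne.
have kn : (reach s' d).-1 < n by lia.
have [||j hj nj] := bruhat_high (p := n + (reach s' d).-1)
    (i := n + (reach s' d).-1) (t := ((n - d)%N%:Z)%R) hb;
      rewrite ?nr ?ne ?size_quarter_turn //; [lia|lia|].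
rewrite zr in hj; have [jE jn] := nr_sub j ltac:(lia).
rewrite -jE nr ?size_quarter_turn // in nj.
have [q hq wq] := signed_perm_succ pw jn; have := nth_quarter_turn pw hq.
rewrite wq /= => nq; rewrite nq in nj.
have wq0 : (w`_q < 0)%R by case: ifP nj => //; lia.
rewrite wq0 in nj.
have [||r1 r2] := reach_of_entry (m := reach s' d) hs hw (q := q) (d := d); [lia|lia|].
by rewrite wq0 /reach in r1 r2 *; lia.
Qed.

(** * The profile of a pattern-avoiding word *)

Lemma contains2 (w : seq int) (a b : int) i j : i < j < size w ->
    (`|(w`_i)%R|%N < `|(w`_j)%R|%N) = (`|a|%N < `|b|%N) ->
    (`|(w`_j)%R|%N < `|(w`_i)%R|%N) = (`|b|%N < `|a|%N) ->
    (w`_i < 0)%R = (a < 0)%R -> (w`_j < 0)%R = (b < 0)%R ->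
  contains w [:: a; b].
Proof.
move=> hij h1 h2 h3 h4; apply/containsP.
exists (nth 0 [:: i; j]); first by case=> [|[|]] //= _; lia.
by case=> [|[|]] // [|[|]] //= _ _; split => //; lia.
Qed.

Lemma contains3 (w : seq int) (a b c : int) i j k : i < j < k -> k < size w ->
    `|b|%N < `|c|%N < `|a|%N -> `|(w`_j)%R|%N < `|(w`_k)%R|%N < `|(w`_i)%R|%N ->
    (w`_i < 0)%R = (a < 0)%R -> (w`_j < 0)%R = (b < 0)%R ->
    (w`_k < 0)%R = (c < 0)%R ->
  contains w [:: a; b; c].
Proof.
move=> hij hk h1 h2 h3 h4 h5; apply/containsP.
exists (nth 0 [:: i; j; k]); first by case=> [|[|[|]]] //= _; lia.
by case=> [|[|[|]]] // [|[|[|]]] //= _ _; split => //; lia.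
Qed.

(** The patterns of length two force entries of different signs to increase in
absolute value, so these are the direct sums of words of constant sign whose
underlying permutations avoid 312. *)
Definition layered_312 (n : nat) (w : seq int) : bool :=
  signed_perm n w && all (fun s => ~~ contains w s)
    [:: [:: 3; 1; 2]; [:: -3; -1; -2]; [:: 2; -1]; [:: -2; 1]]%Z.

(** The reach at d has to be the largest absolute value among the first d + 1
entries.  A larger available value occurring after a smaller entry would complete
a 312, since the prefix maximum precedes both; and where the sign changes the
prefix is a permutation of an initial segment. *)
Lemma encodes_exists n w : layered_312 n w ->
  exists2 s, admissible n s & encodes n s w.
Proof.
move=> /and5P[pw av1 av2 av3 /andP[av4 _]].
have zw := signed_perm_size pw.
have layer i j : i < j < n -> (w`_i < 0)%R != (w`_j < 0)%R ->
    `|(w`_i)%R|%N < `|(w`_j)%R|%N.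
  move=> hij sg; rewrite ltnNge; apply/negP => le.
  have lt : `|(w`_j)%R|%N < `|(w`_i)%R|%N.
    rewrite ltn_neqAle le andbT; apply/eqP => /(signed_perm_inj pw); lia.
  case: (ltrP (w`_i)%R 0%R) sg => si sg.
    by move/negP: av4; apply; apply: (@contains2 _ _ _ i j); rewrite ?zw //; lia.
  by move/negP: av3; apply; apply: (@contains2 _ _ _ i j); rewrite ?zw //; lia.
have av i j k : i < j < k -> k < n ->
    ~ `|(w`_j)%R|%N < `|(w`_k)%R|%N < `|(w`_i)%R|%N.
  move=> hij hk lt.
  have sij : (w`_i < 0)%R = (w`_j < 0)%R.
    by apply/eqP/negPn/negP => /layer; lia.
  have sik : (w`_i < 0)%R = (w`_k < 0)%R.
    by apply/eqP/negPn/negP => /layer; lia.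
  case: (ltrP (w`_i)%R 0%R) => si.
    by move/negP: av2; apply; apply: (@contains3 _ _ _ _ i j k); rewrite ?zw //; lia.
  by move/negP: av1; apply; apply: (@contains3 _ _ _ _ i j k); rewrite ?zw //; lia.
pose m d := \max_(i < d.+1) `|(w`_i)%R|%N.
have m_ge d i : i <= d -> `|(w`_i)%R|%N <= m d.
  by move=> id; apply: (@leq_bigmax _ (fun i : 'I_d.+1 => `|(w`_i)%R|%N) (Ordinal (id : i < d.+1))).
have m_ex d : exists2 i, i <= d & `|(w`_i)%R|%N = m d.
  have [|i ei] := @bigop.eq_bigmax 'I_d.+1 (fun i : 'I_d.+1 => `|(w`_i)%R|%N);
    first by rewrite card_ord.
  by exists i; [rewrite -ltnS ltn_ord | rewrite /m ei].
have m_gt d : d < n -> d < m d <= n.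
  move=> hd; have [i id ei] := m_ex d; have wi := @signed_perm_range n w i pw.
  have {wi} wi := wi (leq_ltn_trans id hd); rewrite ei in wi.
  case: d hd id ei wi => [|d] hd id ei wi; first lia.
  rewrite ltnNge; apply/andP; split; last lia; apply/negP => le.
  have := m_ge _ _ (leqnn d.+1); rewrite leqNgt => /negP; apply.
  apply: (leq_ltn_trans (n := d.+1)) => //; apply: (prefix_pigeonhole pw) => [|j hj]; first lia.
  by apply: (leq_trans _ le); apply: m_ge; lia.
pose s d := (if w`_d < 0 then - (m d - d)%N%:Z else (m d - d)%N%:Z)%R.
have rs d : d < n -> reach s d = m d.
  by move=> /m_gt; rewrite /reach /s; case: ifP => _; lia.
have ss d : d < n -> (s d < 0)%R = (w`_d < 0)%R.
  by move=> /m_gt; rewrite /s; case: ifP => _; lia.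
(* At a change of sign every earlier entry is smaller than every later one. *)
have aj d i : i <= d -> d.+1 < n -> (w`_d < 0)%R != (w`_d.+1 < 0)%R ->
   forall j, d < j < n -> `|(w`_i)%R|%N < `|(w`_j)%R|%N.
  move=> id d1 sg j hj.
  case: (eqVneq (w`_i < 0)%R (w`_j < 0)%R) => [sij|]; last by apply: layer; lia.
  (* If w_i and w_j have equal signs, one of w_d and w_(d + 1) has the opposite
     sign and separates them. *)
  have [e [he si sj]] : exists e, [/\ (e == d) || (e == d.+1), (w`_i < 0)%R != (w`_e < 0)%R
       & (w`_e < 0)%R != (w`_j < 0)%R].
    case: (eqVneq (w`_i < 0)%R (w`_d < 0)%R) => [sid|sid].
      by exists d.+1; split; rewrite ?eqxx ?orbT //; [rewrite sid | rewrite -sij sid eq_sym].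
    by exists d; split; rewrite ?eqxx //; rewrite -sij eq_sym.
  have ie : i < e.
    rewrite ltnNge; apply/negP => ei; have ie : i = e by lia.
    by rewrite ie eqxx in si.
  have ej : e < j.
    rewrite ltnNge; apply/negP => je; have ej : e = j by lia.
    by rewrite ej eqxx in sj.
  by apply: (@ltn_trans `|(w`_e)%R|%N); apply: layer => //; lia.
exists s => [d hd|].
  have md := m_gt d hd; rewrite rs //; split.
  - by rewrite /s; case: ifP; lia.
  - lia.
  - by move=> d1; rewrite rs //; have [i id <-] := m_ex d; apply: m_ge; lia.
  move=> d1; rewrite !ss // => sg.
  suff : m d <= d.+1 by move=> ?; have := rs d hd; rewrite /reach; lia.
  rewrite leqNgt; apply/negP => gt.
  have [|r hr wr] := @suffix_pigeonhole n w d.+1 (m d) pw; first lia.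
  have [i id ei] := m_ex d; have := aj d i id d1 sg r; lia.
split=> // d hd; rewrite rs // ss //; split => //; first exact: m_ge.
move=> e he lt; rewrite ltnNge; apply/negP => de.
have ned : d != e by apply/eqP => ed; rewrite ed ltnn in lt.
have [i id ei] := m_ex d.
have nid : i != d by apply/eqP => e1; rewrite e1 in ei; lia.
have nie : `|(w`_i)%R|%N <> `|(w`_e)%R|%N.
  by move=> /(signed_perm_inj pw); lia.
by apply: (@av i d e); lia.
Qed.

(** * Profiles of Grand-Dyck paths *)

Lemma height0 P : height P 0 = 0%R.
Proof. by rewrite /height take0. Qed.

Lemma height_step P k : k < size P ->
  height P k.+1 = (height P k + (if nth false P k then 1 else - 1))%R.
Proof.
move=> hk; rewrite /height (take_nth false) // -cats1 !count_cat /= !addn0.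
by case: (nth false P k); rewrite /=; lia.
Qed.

Lemma height_oversize P k : size P <= k -> height P k = height P (size P).
Proof. by move=> hk; rewrite /height !take_oversize. Qed.

Lemma height_lipschitz P a b : a <= b -> `|(height P b - height P a)%R|%N <= b - a.
Proof.
elim: b => [|b IH] hab; first by rewrite (eqP (_ : a == 0)) ?subrr; lia.
case: (eqVneq a b.+1) => [->|ne]; first lia.
have le : a <= b by rewrite -ltnS ltn_neqAle ne.
have {IH} := IH le.
case: (ltnP b (size P)) => hb; first by rewrite height_step //; case: (nth _ _ _); lia.
by rewrite (height_oversize (leqW hb)) -(height_oversize hb); lia.
Qed.

Lemma heightE P k : k <= size P ->
  (height P k = k%:Z - (count_mem false (take k P)).*2%:Z)%R.
Proof.
elim: k => [|k IH] hk; first by rewrite height0 take0.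
rewrite height_step // IH ?(ltnW hk) // (take_nth false) // -cats1 count_cat /=.
by case: (nth false P k); lia.
Qed.

Lemma height_end n (P : grand_dyck n) k : n.*2 <= k -> height (val P) k = 0%R.
Proof.
case: P => P /= /andP[/eqP sz /eqP ct] hk.
rewrite height_oversize ?sz // heightE ?sz // take_oversize ?sz //.
have := count_predC (pred1 true) P; rewrite ct sz.
have -> : count (predC (pred1 true)) P = count_mem false P.
  by apply: eq_count => -[].
lia.
Qed.

(** The d-th down step of |P| starts at the abscissa [reach s d] + d, after
[reach s d] up steps and d down steps.  Prescribing the height there and a step
towards the axis characterises it without counting steps. *)
Definition traces (n : nat) (P : seq bool) (s : nat -> int) : Prop :=
  forall d, d < n -> height P (reach s d + d) = s d /\
                     `|height P (reach s d + d).+1|%N.+1 = `|s d|%N.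

Lemma traces_admissible n (P : grand_dyck n) s : traces n (val P) s -> admissible n s.
Proof.
move=> ht d hd; have [h1 h2] := ht d hd; have L := @height_lipschitz (val P).
have rE t : reach s t = `|s t|%N + t by [].
have bound : reach s d <= n.
  have e1 := height_end P (leqnn _).
  have lt : reach s d + d < n.*2.
    by rewrite ltnNge; apply/negP => /(height_end P); lia.
  by have := L _ _ (ltnW lt); have := rE d; lia.
have sd := rE d; have sd1 := rE d.+1.
split; [lia | exact: bound | |] => d1; have [g1 g2] := ht _ d1.
  rewrite leqNgt; apply/negP => lt.
  have ne : reach s d.+1 + d.+1 != reach s d + d.
    by apply/eqP => e; rewrite e in g1; lia.
  by have := L (reach s d.+1 + d.+1).+1 (reach s d + d) ltac:(lia); lia.
move=> sg; have [le|lt] := leqP (reach s d + d).+1 (reach s d.+1 + d.+1).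
  by have := L _ _ le; have := L _ _ (leqnSn (reach s d + d)); lia.
by have := L (reach s d.+1 + d.+1) (reach s d + d) ltac:(lia); lia.
Qed.

(** If P(k) > 0 and d is the number of down steps of |P| before k, then the d-th
down step is the first one from k on, so P(k) <= s d and the path climbs from k to
it.  Together with the fact that heights change by at most 1 per step, this
compares heights with profiles in both directions. *)
Lemma traces_le n (P Q : grand_dyck n) s t :
    traces n (val P) s -> traces n (val Q) t ->
  gd_le P Q <-> forall d, d < n -> (s d <= t d)%R.
Proof.
move=> hs ht.
have rE (r : nat -> int) d : reach r d = `|r d|%N + d by [].
have aux (A : grand_dyck n) (r : nat -> int) d : traces n (val A) r -> d < n ->
   [/\ r d != 0%R, reach r d + d < n.*2 & reach r d <= n].
  move=> hr hd; have [h1 h2] := hr d hd.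
  split; [lia | | by have [] := traces_admissible hr hd].
  by rewrite ltnNge; apply/negP => /(height_end A); lia.
split=> [le d hd|le k hk].
  have [s1 s2] := hs d hd; have [t1 t2] := ht d hd; have rs := rE s d; have rt := rE t d.
  have [z1 k1 b1] := aux _ _ _ hs hd; have [z2 k2 b2] := aux _ _ _ ht hd.
  have l1 := le _ (ltnW k1); have l2 := le _ (ltnW k2).
  rewrite leNgt; apply/negP => lt.
  case: (ltngtP (reach s d) (reach t d)) => c.
  -    have := @height_lipschitz (val P) (reach s d + d).+1 (reach t d + d) ltac:(lia).
    by have := @height_lipschitz (val P) (reach s d + d) (reach s d + d).+1 ltac:(lia); lia.
  - have := @height_lipschitz (val Q) (reach t d + d).+1 (reach s d + d) ltac:(lia).
    by have := @height_lipschitz (val Q) (reach t d + d) (reach t d + d).+1 ltac:(lia); lia.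
  - by rewrite c in l1 s1; lia.
have szP : size (val P) = n.*2 by case: (P) => /= ? /andP[/eqP].
have szQ : size (val Q) = n.*2 by case: (Q) => /= ? /andP[/eqP].
have hP := @heightE (val P) k; have hQ := @heightE (val Q) k.
rewrite szP in hP; rewrite szQ in hQ; have {hP} hP := hP hk; have {hQ} hQ := hQ hk.
have L (A : grand_dyck n) a b : a <= b ->
    `|(height (val A) b - height (val A) a)%R|%N <= b - a.
  exact: height_lipschitz.
have eP := L P _ _ hk; have eQ := L Q _ _ hk.
rewrite (height_end P (leqnn _)) in eP; rewrite (height_end Q (leqnn _)) in eQ.
rewrite leNgt; apply/negP => lt.
case: (ltrP 0%R (height (val P) k)) => p0.
  (* As P(k) > 0, both P and |P| have made d down steps before k. *)
  set d := count _ _ in hP.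
  have hd : d < n by lia.
  have [s1 s2] := hs d hd; have [t1 t2] := ht d hd; have rs := rE s d; have rt := rE t d.
  have led := le d hd.
  have ks : k <= reach s d + d.
    by rewrite leqNgt; apply/negP => ?; have := L P (reach s d + d).+1 k ltac:(lia); lia.
  have sp : (0 < s d)%R by have := L P _ _ ks; lia.
  have kt : k <= reach t d + d by lia.
  by have := L Q _ _ kt; lia.
set c := count _ _ in hQ; have ck : c <= k.
  by apply: leq_trans (count_size _ _) _; rewrite size_take_min szQ; lia.
(* As Q(k) < 0, before k the path |Q| has made as many down steps as Q has made
   up steps. *)
pose d := k - c; have hd : d < n by rewrite /d; lia.
have dE : (height (val Q) k = d.*2%:Z - k%:Z)%R.
  by rewrite hQ /d; lia.
have [s1 s2] := hs d hd; have [t1 t2] := ht d hd; have rs := rE s d; have rt := rE t d.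
have led := le d hd; clearbody d.
have kt : k <= reach t d + d.
  by rewrite leqNgt; apply/negP => ?; have := L Q (reach t d + d).+1 k ltac:(lia); lia.
have tn : (t d < 0)%R by have := L Q _ _ kt; lia.
have ks : k <= reach s d + d by lia.
by have := L P _ _ ks; lia.
Qed.

(** The down steps of |P| have to be at the abscissas [reach s d] + d, which
increase strictly with d; the side of the axis is that of the next down step. *)
Lemma traces_exists n s : admissible n s -> exists P : grand_dyck n, traces n (val P) s.
Proof.
move=> hs; pose kappa d := reach s d + d.
(* cnt k is the number of those abscissas below k. *)
pose cnt := fix cnt k := if k is k'.+1 then cnt k' + (k' == kappa (cnt k')) else 0.
have cS k : cnt k.+1 = cnt k + (k == kappa (cnt k)) by [].
have kap d : d < n -> d < reach s d <= n.
  by move=> hd; have [z b _ _] := hs d hd; rewrite /reach in b *; lia.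
have mono d : d.+1 < n -> kappa d < kappa d.+1.
  by move=> hd; have [|_ _ /(_ hd) le _] := hs d; rewrite /kappa; lia.
have kapS d : 0 < d < n -> kappa d.-1 < kappa d.
  by move=> hd; have := mono d.-1; rewrite prednK; [apply; lia | lia].
have kapL d : d.+1 = n -> kappa d = (d + n).
  by move=> hd; rewrite /kappa; have := kap d; lia.
have lt_n k c : k < n.*2 -> c <= n -> (0 < c -> kappa c.-1 < k) -> c < n.
  move=> hk i1 i3; rewrite ltn_neqAle i1 andbT; apply/eqP => e; rewrite e in i3.
  case: (posnP n) => [n0|n0]; first by rewrite n0 in hk.
  have := kapL n.-1 (prednK n0); have := i3 n0; lia.
have inv k : k <= n.*2 -> [/\ cnt k <= n, cnt k < n -> k <= kappa (cnt k)
    & 0 < cnt k -> kappa (cnt k).-1 < k].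
  elim: k => [|k IH] hk; first by rewrite /=; split; lia.
  have [i1 i2 i3] := IH (ltnW hk); rewrite cS.
  have lt := lt_n _ _ hk i1 i3.
  have {}i2 := i2 lt; case: eqP => e; rewrite ?addn1 ?addn0; split => //.
  - by move=> h; have := mono _ h; lia.
  - by move=> _ /=; lia.
  - by move=> _; lia.
  - by move=> h; have := i3 h; lia.
have cntk d : d < n -> cnt (kappa d) = d.
  move=> hd; have kb : kappa d <= n.*2 by have := kap d hd; rewrite /kappa; lia.
  have [i1 i2 i3] := inv _ kb.
  have km a b : a < b < n -> kappa a < kappa b.
    elim: b => [|b IHb] ab; first lia.
    case: (eqVneq a b) => [->|ne]; first by apply: mono; lia.
    by apply: ltn_trans (IHb _) (mono _ _); lia.
  case: (ltngtP (cnt (kappa d)) d) => // c.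
    by have := i2 (ltn_trans c hd); have := km _ d (introT andP (conj c hd)); lia.
  have c0 : 0 < cnt (kappa d) by lia.
  have := i3 c0; case: (eqVneq d (cnt (kappa d)).-1) => [<-|ne]; first by rewrite ltnn.
  by have := km d (cnt (kappa d)).-1; lia.
have cntN : cnt n.*2 = n.
  case: (posnP n) => [->//|n0].
  have [i1 i2 _] := inv _ (leqnn _).
  apply/eqP; rewrite eqn_leq i1 leqNgt; apply/negP => lt.
  by have := i2 lt; have := kap _ lt; rewrite /kappa; lia.
pose P := mkseq (fun k => (k != kappa (cnt k)) (+) (s (cnt k) < 0)%R) n.*2.
have szP : size P = n.*2 by rewrite size_mkseq.
have hP k : k <= n.*2 ->
    height P k = (if s (cnt k) < 0 then (cnt k).*2%:Z - k%:Z else k%:Z - (cnt k).*2%:Z)%R.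
  elim: k => [|k IH] hk; first by rewrite height0 /=; case: ifP.
  rewrite height_step ?szP // IH ?(ltnW hk) // nth_mkseq // cS.
  have [i1 i2 i3] := inv k (ltnW hk); have hd := lt_n _ _ hk i1 i3.
  case: eqP => e /=; last by rewrite addn0; case: ifP => /=; lia.
  rewrite addn1; set d := cnt k in e i1 i2 i3 hd *.
  have [z b _ sg] := hs d hd.
  have k1 : `|s d|%N = 1 -> k.+1 = d.+1.*2 by rewrite e /kappa /reach; lia.
  case: (ltnP d.+1 n) => [d1|dn].
    by case: (eqVneq (s d < 0)%R (s d.+1 < 0)%R) => [<-|/(sg d1) /k1];
      case: (s d < 0)%R => /=; case: (s d.+1 < 0)%R => /=; lia.
  have dn1 : d.+1 = n by lia.
  have := kapL d dn1; rewrite -e => k2.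
  by case: (s d < 0)%R => /=; case: (s d.+1 < 0)%R => /=; lia.
have ctP : count_mem true P = n.
  have := heightE (leqnn (size P)); rewrite take_size szP hP // cntN.
  have := count_predC (pred1 true) P; rewrite szP.
  have -> : count (predC (pred1 true)) P = count_mem false P by apply: eq_count => -[].
  by case: ifP => _; lia.
have gP : (size P == n.*2) && (count_mem true P == n) by rewrite szP ctP !eqxx.
exists (exist _ P gP) => d hd /=; rewrite -/(kappa d).
have kb : kappa d < n.*2 by have := kap d hd; have := kapL d; rewrite /kappa; lia.
rewrite height_step ?szP // hP ?(ltnW kb) // cntk // nth_mkseq // cntk // eqxx /=.
have [z _ _ _] := hs d hd.
by rewrite /kappa /reach; case: (ltrP (s d) 0%R) => sd /=; lia.
Qed.

(** * Matching and runs of down steps *)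

Lemma height_reflect P k : k <= size P ->
  height (reflect_path P) k = `|height P k|%N%:Z%R.
Proof.
elim: k => [|k IH] hk; first by rewrite !height0.
have szr : size (reflect_path P) = size P by rewrite size_mkseq.
rewrite height_step ?szr // IH ?(ltnW hk) // nth_mkseq // /below_axis.
by rewrite height_step //; case: (nth false P k); case: ifP; lia.
Qed.

Definition ups (Q : seq bool) (k : nat) : nat := count_mem true (take k Q).
Definition downs (Q : seq bool) : seq nat :=
  [seq b <- iota 0 (size Q) | ~~ nth true Q b].
Definition mate (Q : seq bool) (b : nat) : nat :=
  find (matched Q ^~ b) (iota 0 (size Q)).

Lemma upsS Q k : k < size Q -> ups Q k.+1 = ups Q k + nth false Q k.
Proof.
move=> hk; rewrite /ups (take_nth false) // -cats1 count_cat /= addn0.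
by case: (nth false Q k).
Qed.

Lemma leq_ups Q j k : j <= k -> ups Q j <= ups Q k.
Proof.
move=> jk; rewrite /ups -(subnKC jk) takeD count_cat; exact: leq_addr.
Qed.

Lemma matchedP Q a b : reflect
  [/\ a < b < size Q, nth false Q a, ~~ nth false Q b, height Q b.+1 = height Q a
    & forall k, a < k <= b -> (height Q a < height Q k)%R]
  (matched Q a b).
Proof.
apply: (iffP and5P) => -[h1 h2 h3 h4 h5]; split => //; try exact/eqP.
  by move=> k hk; apply: (allP h5); rewrite mem_index_iota.
by apply/allP => k; rewrite mem_index_iota => hk; apply: h5.
Qed.

Lemma matched_injl Q a a' b : matched Q a b -> matched Q a' b -> a = a'.
Proof.
move=> /matchedP[h1 _ _ h4 h5] /matchedP[g1 _ _ g4 g5].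
case: (ltngtP a a') => // l; first by have := h5 a'; lia.
by have := g5 a; lia.
Qed.

Lemma matched_injr Q a b b' : matched Q a b -> matched Q a b' -> b = b'.
Proof.
move=> /matchedP[h1 _ _ h4 h5] /matchedP[g1 _ _ g4 g5].
case: (ltngtP b b') => // l; first by have := g5 b.+1; lia.
by have := h5 b'.+1; lia.
Qed.

(** Matched pairs do not cross: the height at b + 1 equals that at a, which is
too low to lie strictly inside the pair of a'. *)
Lemma matched_nested Q a b a' b' : matched Q a b -> matched Q a' b' ->
  a < a' < b -> b' < b.
Proof.
move=> mab mab' l; rewrite ltnNge; apply/negP => le.
have [h1 _ _ h4 h5] := matchedP _ _ _ mab; have [g1 _ _ g4 g5] := matchedP _ _ _ mab'.
case: (eqVneq b b') => [e|ne].
  by rewrite -e in mab'; have := matched_injl mab mab'; lia.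
by have := g5 b.+1; have := h5 a'; lia.
Qed.

Definition nonnegative (Q : seq bool) : Prop :=
  forall k, k <= size Q -> (0 <= height Q k)%R.

Lemma downP Q b : b \in downs Q = (b < size Q) && ~~ nth false Q b.
Proof.
rewrite mem_filter mem_iota add0n andbC leq0n /=.
by case: ltnP => // hb; rewrite (set_nth_default false).
Qed.

Lemma down_height Q b : b \in downs Q -> (height Q b = height Q b.+1 + 1)%R.
Proof. by rewrite downP => /andP[hb /negbTE nb]; rewrite height_step // nb; lia. Qed.

(** The mate of a down step is the last up step before it that starts below the
level at which the down step starts. *)
Lemma mate_matched Q b : nonnegative Q -> b \in downs Q -> matched Q (mate Q b) b.
Proof.
move=> Q_ge0 db; have := down_height db; have := db; rewrite downP => /andP[hb nb] hstep.
have h1 := Q_ge0 _ hb.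
pose p a := (a < b) && (height Q a < height Q b)%R.
have ex : exists a, p a.
  by exists 0; rewrite /p height0; case: b {p db nb} hb hstep h1 => [|b]; rewrite ?height0; lia.
have ubd a : p a -> a <= b by case/andP => /ltnW.
suff hm : has (matched Q ^~ b) (iota 0 (size Q)).
  have := nth_find 0 hm; rewrite -/(mate Q b) nth_iota //.
  by move: hm; rewrite has_find size_iota.
case: (ex_maxnP ex ubd) => a /andP[ab ha] mx.
have above k : a < k <= b -> (height Q b <= height Q k)%R.
  move=> hk; case: (eqVneq k b) => [->//|ne]; rewrite leNgt; apply/negP => l.
  by have := mx k; rewrite /p l andbT; lia.
have ha1 := above a.+1; have sa := @height_step Q a (ltn_trans ab hb).
apply/hasP; exists a; first by rewrite mem_iota; lia.
apply/matchedP; split => //; first lia.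
- by move: sa; case: (nth false Q a) => // sa; lia.
- by move: sa; case: (nth false Q a) => sa; lia.
- by move=> k hk; have := above k hk; lia.
Qed.

Lemma down_runsP Q r : (r \in down_runs Q) = max_down_run Q r.1 r.2.
Proof.
rewrite mem_filter; case: (boolP (max_down_run Q r.1 r.2)) => // h.
rewrite andTb; have /and4P[hr _ _ _] := h; apply/allpairsP; exists r.
by rewrite !mem_iota -surjective_pairing; split=> //; lia.
Qed.

Lemma run_downs Q r b : r \in down_runs Q -> r.1 <= b < r.2 -> b \in downs Q.
Proof.
rewrite down_runsP downP => /and4P[hr /allP hd _ _] hb.
have hbs : b < size Q by lia.
by rewrite hbs /= (set_nth_default true) // hd // mem_index_iota.
Qed.

Lemma run_before Q r : nonnegative Q -> r \in down_runs Q ->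
  0 < r.1 /\ nth false Q r.1.-1.
Proof.
move=> hQ hr; have := hr; rewrite down_runsP => /and4P[h1 _ h3 _].
have r0 : 0 < r.1.
  rewrite lt0n; apply/eqP => e.
  have := down_height (run_downs hr (b := 0) ltac:(lia)); rewrite height0.
  have := hQ 1; lia.
split => //; rewrite (set_nth_default true); last lia.
by move: h3; rewrite -[_ == 0]negbK -lt0n r0.
Qed.

Lemma run_height Q r k : r \in down_runs Q -> r.1 <= k <= r.2 ->
  height Q k = (height Q r.1 - (k - r.1)%N%:Z)%R.
Proof.
move=> hr; elim: k => [|k IH] hk.
  have r10 : r.1 = 0 by lia.
  by rewrite r10 subr0.
case: (eqVneq r.1 k.+1) => [->|ne]; first by rewrite subnn subr0.
have hk' : r.1 <= k < r.2 by lia.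
by have := down_height (run_downs hr hk'); have := IH ltac:(lia); lia.
Qed.

(** Along a run the heights decrease, and so do the starting heights of the mates;
a mate cannot lie in the run itself. *)
Lemma mate_run Q r b b' : nonnegative Q -> r \in down_runs Q ->
  r.1 <= b -> b < b' -> b' < r.2 -> mate Q b' < mate Q b.
Proof.
move=> hQ hr h1 h2 h3.
have hb : r.1 <= b < r.2 by lia. have hb' : r.1 <= b' < r.2 by lia.
have /matchedP[m1 _ _ m4 m5] := mate_matched hQ (run_downs hr hb).
have /matchedP[g1 _ _ g4 g5] := mate_matched hQ (run_downs hr hb').
have e := @run_height _ _ b.+1 hr ltac:(lia); have e' := @run_height _ _ b'.+1 hr ltac:(lia).
rewrite ltnNge; apply/negP => le.
case: (leqP (mate Q b') b) => l.
  by case: (eqVneq (mate Q b) (mate Q b')) => [q|ne];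
    [rewrite q in m4 | have := m5 (mate Q b')]; lia.
have := @run_height _ _ (mate Q b') hr ltac:(lia); lia.
Qed.

Lemma mate_run_start Q r : nonnegative Q -> r \in down_runs Q ->
  mate Q r.1 = r.1.-1.
Proof.
move=> hQ hr; have [r0 u] := run_before hQ hr.
have := hr; rewrite down_runsP => /and4P[h1 _ _ _].
have hd := run_downs hr (b := r.1) ltac:(lia).
apply: (matched_injl (mate_matched hQ hd)).
have := hd; rewrite downP => /andP[h2 h3].
have := @height_step Q r.1.-1 ltac:(lia); rewrite u prednK // => h4.
have := down_height hd => h5.
apply/matchedP; split => //; [lia | lia |].
by move=> k hk; have kr : k = r.1; [lia | rewrite kr; lia].
Qed.

Lemma run_exists Q b : b \in downs Q ->
  exists2 r, r \in down_runs Q & r.1 <= b < r.2.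
Proof.
rewrite downP => /andP[hb nb].
pose p s := (s <= b) && all (fun k => ~~ nth true Q k) (index_iota s b.+1).
have exs : exists s, p s.
  exists b; rewrite /p leqnn /index_iota subSnn /= andbT.
  by rewrite (set_nth_default false).
pose q e := (b < e) && nth true Q e.
have exe : exists e, q e by exists (size Q); rewrite /q hb nth_default.
case: (ex_minnP exs) => s /andP[sb /allP sall] smin.
case: (ex_minnP exe) => e /andP[be eup] emin.
have el : e <= size Q by apply: emin; rewrite /q hb nth_default.
exists (s, e); last by rewrite /= sb.
rewrite down_runsP /=; apply/and4P; split => //; first lia.
  apply/allP => k; rewrite mem_index_iota => hk.
  case: (leqP k b) => kb; first by apply: sall; rewrite mem_index_iota; lia.
  by apply/negP => up; have := emin k; rewrite /q kb up; lia.
case: s sb sall smin => [|s] //= sb sall smin; apply/negPn/negP => nu.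
suff : s.+1 <= s by rewrite ltnn.
apply: smin; rewrite /p; apply/andP; split; first lia.
apply/allP => k; rewrite mem_index_iota => hk.
case: (eqVneq k s) => [->//|ks]; apply: sall; rewrite mem_index_iota; lia.
Qed.

(** The runs are listed lexicographically, and distinct maximal runs are
separated by an up step. *)
Lemma down_runs_pairwise Q : pairwise (fun r r' => r.2 <= r'.1) (down_runs Q).
Proof.
pose lex (r r' : nat * nat) := (r.1 < r'.1) || ((r.1 == r'.1) && (r.2 < r'.2)).
have lexP xs ys : pairwise ltn xs -> pairwise ltn ys ->
    pairwise lex [seq (x, y) | x <- xs, y <- ys].
  move=> + hy; elim: xs => [//|x xs IH] /=; rewrite pairwise_cat => /andP[/allP hx /IH ->].
  rewrite andbT pairwise_map; apply/andP; split.
    apply/allrelP => _ _ /mapP[y _ ->] /allpairsP[z [z1 _ ->]] /=.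
    by rewrite /lex /= (hx _ z1 : x < z.1).
  by apply: sub_pairwise hy => y y' /= hyy; rewrite /lex /= eqxx hyy orbT.
have : pairwise lex (down_runs Q).
  by apply: pairwise_filter; apply: lexP; rewrite -(sorted_pairwise ltn_trans) iota_ltn_sorted.
have hall : all [in down_runs Q] (down_runs Q) by apply/allP.
apply: (sub_in_pairwise _ hall) => -[i j] [i' j'] hr hr'.
have := hr' : (i', j') \in down_runs Q; have := hr : (i, j) \in down_runs Q.
rewrite !down_runsP /lex /= => /and4P[h1 /allP h2 h3 h4] /and4P[g1 /allP g2 g3 g4].
case/orP=> [l|/andP[/eqP e l]].
  rewrite leqNgt; apply/negP => c.
  have : i'.-1 \in index_iota i j by rewrite mem_index_iota; lia.
  by move=> /h2; case/orP: g3 => [|->//]; lia.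
by have : j \in index_iota i' j'; [rewrite mem_index_iota; lia | move=> /g2; rewrite h4].
Qed.

Lemma flatten_down_runs Q :
  flatten [seq index_iota r.1 r.2 | r <- down_runs Q] = downs Q.
Proof.
apply: (irr_sorted_eq ltn_trans ltnn).
- rewrite (sorted_pairwise ltn_trans).
  elim: (down_runs Q) (down_runs_pairwise Q) => //= r rs IH /andP[/allP hr /IH {}IH].
  rewrite pairwise_cat IH andbT -(sorted_pairwise ltn_trans) iota_ltn_sorted andbT.
  apply/allrelP => x y; rewrite mem_index_iota => hx /flattenP[ys /mapP[r' /hr lr ->]].
  by rewrite mem_index_iota; lia.
- by apply: sorted_filter; [exact: ltn_trans | exact: iota_ltn_sorted].
move=> b; apply/flattenP/idP => [[ys /mapP[r hr ->]]|/run_exists[r hr hb]].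
  by rewrite mem_index_iota; apply: run_downs.
by exists (index_iota r.1 r.2); [apply: map_f | rewrite mem_index_iota].
Qed.

(** * The word of a path *)

Lemma reflect_nonnegative P : nonnegative (reflect_path P).
Proof. by move=> k; rewrite size_mkseq => /height_reflect ->. Qed.

Lemma below_axis_down P b : b \in downs (reflect_path P) ->
  below_axis P b = (height P b < 0)%R.
Proof.
move=> hb; have := down_height hb; have := hb; rewrite downP size_mkseq => /andP[hs _].
by rewrite !height_reflect ?(ltnW hs) // /below_axis => e; have := height_step hs;
  case: ifP => _; lia.
Qed.

(** Within a run |P| only reaches the axis after the last step, so the whole run
is on one side. *)
Lemma below_axis_run P r b : r \in down_runs (reflect_path P) -> r.1 <= b < r.2 ->
  below_axis P b = all (below_axis P) (index_iota r.1 r.2).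
Proof.
move=> hr hb.
have key k : r.1 <= k < r.2 -> below_axis P k = below_axis P r.1.
  elim: k => [|k IH] hk; first by congr (below_axis P _); lia.
  case: (eqVneq r.1 k.+1) => [->//|ne]; have hk' : r.1 <= k < r.2 by lia.
  rewrite -(IH hk').
  have d1 := run_downs hr hk; have d0 := run_downs hr hk'.
  rewrite !below_axis_down //.
  have := down_height d0; have := down_height d1.
  have := d1; rewrite downP size_mkseq => /andP[hs _].
  rewrite !height_reflect //; try lia; move=> e1 e0.
  by have := @height_lipschitz P k k.+1 (leqnSn k); lia.
rewrite (key b hb); apply/idP/allP => [h k|h].
  by rewrite mem_index_iota => hk; rewrite key.
by apply: h; rewrite mem_index_iota; lia.
Qed.

(** Mates decrease along a run, so reading the run from left to right lists its
block in decreasing order. *)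
Lemma run_block_sorted Q r : nonnegative Q -> r \in down_runs Q ->
  sort geq (run_block Q r) = [seq up_label Q (mate Q b) | b <- index_iota r.1 r.2].
Proof.
move=> hQ hr; set B := [seq _ | b <- _].
have dn b : b \in index_iota r.1 r.2 -> matched Q (mate Q b) b.
  by rewrite mem_index_iota => hb; apply: mate_matched => //; apply: run_downs hr hb.
have sB : sorted geq B.
  apply: pairwise_sorted; rewrite pairwise_map.
  have : pairwise ltn (index_iota r.1 r.2).
    by rewrite -(sorted_pairwise ltn_trans) iota_ltn_sorted.
  have hall : all (mem (index_iota r.1 r.2)) (index_iota r.1 r.2) by apply/allP.
  apply: (sub_in_pairwise _ hall) => b b'.
  move=> hb hb' /= lt; have {}hb : b \in index_iota r.1 r.2 := hb.
  have {}hb' : b' \in index_iota r.1 r.2 := hb'.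
  move: hb hb'; rewrite !mem_index_iota => hb hb'; apply: leq_ups.
  by have := mate_run hQ hr (b := b) (b' := b'); lia.
have tr : transitive geq by move=> x y z /= h1 h2; apply: leq_trans h2 h1.
have as_ : antisymmetric geq by move=> x y /= h; apply/eqP; rewrite eqn_leq andbC.
have tot : total geq by move=> x y; apply: leq_total.
rewrite -(sorted_sort tr sB); apply/(perm_sortP tot tr as_).
rewrite /run_block /B (map_comp (up_label Q) (mate Q)); apply: perm_map; apply: uniq_perm.
- by apply: filter_uniq; apply: iota_uniq.
- rewrite map_inj_in_uniq ?iota_uniq // => b b' hb hb' e.
  by apply: matched_injr (dn b hb) _; rewrite e; apply: dn.
move=> a; rewrite mem_filter; apply/andP/mapP => [[/hasP[b hb m] _]|[b hb ->]].
  by exists b => //; apply: matched_injl m (dn b hb).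
split; first by apply/hasP; exists b => //; apply: dn.
by have /matchedP[h _ _ _ _] := dn b hb; rewrite mem_iota; lia.
Qed.

(** The maximum of a block is the label of the up step just before its run, so
the order of the runs is the standard order of the blocks, and without bars the
labels of the mates of all down steps appear from left to right. *)
Lemma remove_bars_path P (Q := reflect_path P) :
  remove_bars (partition_of_path P) =
    [seq (if below_axis P b then - (up_label Q (mate Q b))%:Z
          else (up_label Q (mate Q b))%:Z)%R | b <- downs Q].
Proof.
have hQ := reflect_nonnegative (P := P); rewrite -/Q in hQ.
pose B r := [seq up_label Q (mate Q b) | b <- index_iota r.1 r.2].
pose c (r : nat * nat) := all (below_axis P) (index_iota r.1 r.2).
have e1 : [seq (sort geq b.1, b.2) | b <- partition_of_path P] =
          [seq (B r, c r) | r <- down_runs Q].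
  rewrite /partition_of_path -map_comp; apply/eq_in_map => r hr /=.
  by rewrite run_block_sorted.
have dn r b : r \in down_runs Q -> r.1 <= b < r.2 -> matched Q (mate Q b) b.
  by move=> hr hb; apply: mate_matched => //; apply: run_downs hr hb.
have srt : pairwise (fun b c : seq nat * bool => block_max b.1 <= block_max c.1)
    [seq (B r, c r) | r <- down_runs Q].
  rewrite pairwise_map; have hall : all (mem (down_runs Q)) (down_runs Q) by apply/allP.
  apply: (sub_in_pairwise _ hall) (down_runs_pairwise Q) => -[i j] [i' j'] hr hr' /= le.
  have {}hr : (i, j) \in down_runs Q := hr; have {}hr' : (i', j') \in down_runs Q := hr'.
  have [i0 _] := run_before hQ hr'; rewrite /= in i0.
  have ij : i' < j' by have := hr'; rewrite down_runsP => /and4P[/andP[]].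
  (* The run (i', j') starts with the mate of the up step i' - 1. *)
  have : ups Q i' <= block_max (B (i', j')).
    apply: (@leq_bigmax_seq nat _ xpredT id) => //; apply/mapP; exists i'.
      by rewrite mem_index_iota /=; lia.
    by rewrite (mate_run_start hQ hr') /= /up_label prednK.
  apply: leq_trans; apply/bigmax_leqP_seq => x /mapP[b]; rewrite mem_index_iota => hb -> _.
  have /matchedP[h _ _ _ _] := dn _ b hr hb; apply: leq_ups; rewrite /= in hb; lia.
rewrite /remove_bars /standard_form e1 pairwise_sort // -flatten_down_runs map_flatten -!map_comp.
congr flatten; apply/eq_in_map => r hr /=; rewrite -map_comp; apply/eq_in_map => b.
by rewrite mem_index_iota => hb /=; rewrite /c -(below_axis_run hr hb).
Qed.

Lemma nth_filter_iota (p : pred nat) N d (s := [seq k <- iota 0 N | p k]) :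
  d < size s -> count p (iota 0 (nth 0 s d)) = d.
Proof.
move=> hd; have hb : nth 0 s d \in s by apply: mem_nth.
set b := nth 0 s d in hb *; move: (hb); rewrite mem_filter mem_iota => /andP[pb hbN].
have us : uniq s by apply: filter_uniq; apply: iota_uniq.
have <- : index b s = d by apply: index_uniq.
have e : iota 0 N = iota 0 b ++ b :: iota b.+1 (N - b.+1).
  have {1}-> : N = b + (N - b.+1).+1 by lia.
  by rewrite iotaD.
rewrite /s e filter_cat index_cat mem_filter mem_iota ltnn andbF /= pb /= eqxx addn0.
by rewrite size_filter.
Qed.

Lemma count_downs Q k : k <= size Q ->
  count (fun j => ~~ nth true Q j) (iota 0 k) = count_mem false (take k Q).
Proof.
elim: k => [|k IH] hk; first by rewrite take0.
rewrite -addn1 iotaD count_cat IH ?(ltnW hk) // addn1 (take_nth true) // -cats1 count_cat /=.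
by case: (nth true Q k).
Qed.

(** A label larger than the popped one and pushed before belongs to an up step
nested inside the matched pair, whose down step comes earlier. *)
Lemma path_encodes n (P : grand_dyck n) :
  exists2 s, traces n (val P) s & encodes n s (remove_bars (partition_of_path (val P))).
Proof.
have szP : size (val P) = n.*2 by case: (P) => /= ? /andP[/eqP].
have endP := height_end P (leqnn _); set p : seq bool := val P in szP endP *.
set Q := reflect_path p; have szQ : size Q = n.*2 by rewrite size_mkseq.
have hQ : nonnegative Q := reflect_nonnegative (P := p).
have hE k : k <= n.*2 -> height Q k = `|height p k|%N%:Z%R.
  by move=> hk; rewrite height_reflect ?szP.
have szD : size (downs Q) = n.
  rewrite size_filter count_downs // take_size.
  have := heightE (leqnn (size Q)); rewrite take_size szQ hE // endP; lia.
pose b d := nth 0 (downs Q) d.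
have bD d : d < n -> b d \in downs Q by move=> hd; apply: mem_nth; rewrite szD.
have bQ d : d < n -> b d < n.*2 by move=> /bD; rewrite downP szQ => /andP[].
have bh d : d < n -> (height Q (b d) = (b d)%:Z - d.*2%:Z)%R.
  move=> hd; rewrite heightE ?szQ ?(ltnW (bQ d hd)) // -count_downs ?szQ ?(ltnW (bQ d hd)) //.
  by rewrite nth_filter_iota // szD.
pose s d := height p (b d).
have sE d : d < n -> reach s d + d = b d.
  by move=> hd; have := bh d hd; have := hQ (b d);
    rewrite szQ hE ?(ltnW (bQ d hd)) // /reach /s; lia.
have upsE d : d < n -> ups Q (b d) = reach s d.
  move=> hd; have := sE d hd; have := bh d hd; have hb := ltnW (bQ d hd).
  rewrite heightE ?szQ //; have := count_predC (pred1 true) (take (b d) Q).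
  have -> : count (predC (pred1 true)) (take (b d) Q) = count_mem false (take (b d) Q).
    by apply: eq_count => -[].
  by rewrite size_takel ?szQ // /ups; lia.
have tr : traces n p s.
  move=> d hd; rewrite sE //; split => //.
  have := down_height (bD d hd); rewrite !hE ?(ltnW (bQ d hd)) ?bQ // /s; lia.
exists s => //; rewrite remove_bars_path -/Q; set w := map _ _.
have mD d : d < n -> matched Q (mate Q (b d)) (b d) by move=> /bD; apply: mate_matched.
pose l d := up_label Q (mate Q (b d)).
have lE d : d < n -> l d = ups Q (mate Q (b d)).+1 by [].
have lS d : d < n -> l d = (ups Q (mate Q (b d))).+1.
  move=> hd; have /matchedP[h u _ _ _] := mD d hd.
  by rewrite lE // upsS ?u ?addn1 //; lia.
have wE d : d < n -> (w`_d = if s d < 0 then - (l d)%:Z else (l d)%:Z)%R.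
  by move=> hd; rewrite (nth_map 0) ?szD // below_axis_down // bD.
have wabs d : d < n -> `|(w`_d)%R|%N = l d by move=> hd; rewrite wE //; case: ifP; lia.
have lb d : d < n -> l d <= reach s d.
  move=> hd; have /matchedP[h _ _ _ _] := mD d hd.
  by rewrite -upsE // lE //; apply: leq_ups; lia.
have l_lt d e : d < n -> e < n -> l d < l e -> mate Q (b d) < mate Q (b e).
  move=> hd he; rewrite !lS // ltnS; apply: contraTT; rewrite -!leqNgt; exact: leq_ups.
split.
  have szw : size w = n by rewrite size_map.
  apply: signed_permI => // [d hd|d e hd he].
    by rewrite wabs //; have := lS d hd; have := lb d hd; have [] := traces_admissible tr hd; lia.
  rewrite !wabs // => el.
  have em : mate Q (b d) = mate Q (b e).
    have ld := lS d hd; have le := lS e he.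
    case: (ltngtP (mate Q (b d)) (mate Q (b e))) => // /(leq_ups Q);
      by rewrite -lE //; lia.
  have : b d = b e by apply: matched_injr (mD d hd) _; rewrite em; apply: mD.
  by move/eqP; rewrite nth_uniq ?szD ?filter_uniq ?iota_uniq // => /eqP.
move=> d hd; split; first by rewrite wabs ?lb.
  by rewrite wE //; have := lS d hd; case: ifP; lia.
move=> e he; rewrite !wabs // => /andP[l1 l2]; have m1 := l_lt _ _ hd he l1.
have m2 : mate Q (b e) < b d.
  rewrite ltnNge; apply/negP => /(leq_ups Q); rewrite upsE // => l3.
  by have := lS e he; lia.
have := matched_nested (mD d hd) (mD e he); rewrite m1 m2 => /(_ isT) lt.
rewrite ltnNge; apply/negP => de; move: lt; rewrite ltnNge => /negP; apply.
apply: (sorted_leq_nth leq_trans leqnn) => //; rewrite ?inE ?szD //.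
by apply: sorted_filter; [exact: leq_trans | exact: iota_sorted].
Qed.

(** An occurrence of the turned pattern in the turned word becomes, after three
further turns, an occurrence of the pattern in the word. *)
Lemma quarter_turn_avoid n ps qs w : all (fun s => signed_perm (size s) s) ps ->
    {subset qs <= map quarter_turn ps} ->
    signed_perm n w && all (fun s => ~~ contains w s) ps ->
  signed_perm n (quarter_turn w) && all (fun s => ~~ contains (quarter_turn w) s) qs.
Proof.
move=> /allP hps sub /andP[hw /allP av]; rewrite quarter_turn_signed_perm //=.
apply/allP => _ /sub/mapP[s hs ->]; apply/negP => c.
have h1 := quarter_turn_signed_perm hw; have g1 := quarter_turn_signed_perm (hps s hs).
have h2 := quarter_turn_signed_perm h1; have g2 := quarter_turn_signed_perm g1.
have h3 := quarter_turn_signed_perm h2; have g3 := quarter_turn_signed_perm g2.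
have := contains_quarter_turn h3 g3 (contains_quarter_turn h2 g2 (contains_quarter_turn h1 g1 c)).
by rewrite (quarter_turn4 hw) (quarter_turn4 (hps s hs)); apply/negP/av.
Qed.

Theorem corollary3p2 (n : nat) (n_ge1 : (1 <= n)%N) :
  order_isomorphic
    (@transported_le n [:: [:: 3; 1; 2]; [:: -3; -1; -2]; [:: 2; -1]; [:: -2; 1]]%Z)
    (@bruhatB_le n [:: [:: 2; 1; 3]; [:: -2; -1; -3]; [:: 1; -2]; [:: -1; 2]]%Z).
Proof.
set ps := [:: [:: 3; 1; 2]; _; _; _]%Z; set qs := [:: [:: 2; 1; 3]; _; _; _]%Z.
pose av w p := signed_perm n w && all (fun s => ~~ contains w s) p.
have fP w : av w ps -> av (quarter_turn w) qs by apply: quarter_turn_avoid; last exact/allP.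
have gP w : av w qs -> av (quarter_turn (quarter_turn (quarter_turn w))) ps.
  move=> h; apply: (@quarter_turn_avoid _ (map quarter_turn (map quarter_turn qs))) => //;
    first exact/allP.
  apply: (@quarter_turn_avoid _ (map quarter_turn qs)) => //.
  exact: (@quarter_turn_avoid _ qs).
exists (fun x : avoiders n ps => exist _ (quarter_turn (val x)) (fP _ (valP x))).
split.
  exists (fun y : avoiders n qs =>
            exist _ (quarter_turn (quarter_turn (quarter_turn (val y)))) (gP _ (valP y))) => x.
    by have /andP[hx _] := valP x; apply: val_inj; apply: quarter_turn4 hx.
  by have /andP[hx _] := valP x; apply: val_inj; apply: quarter_turn4 hx.
move=> x y; rewrite /bruhatB_le /=; split=> [[P [Q [<- <- le]]]|hb].
  have [s hs es] := path_encodes P; have [t ht et] := path_encodes Q.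
  apply: bruhat_of_leq (traces_admissible hs) (traces_admissible ht) es et _.
  exact: (traces_le hs ht).1.
have [s as_ es] := encodes_exists (valP x); have [t at_ et] := encodes_exists (valP y).
have [P hP] := traces_exists as_; have [Q hQ] := traces_exists at_.
(* A path has only one profile, and a profile encodes only one word. *)
have code (A : grand_dyck n) r w : traces n (val A) r -> admissible n r -> encodes n r w ->
    remove_bars (partition_of_path (val A)) = w.
  move=> h1 h2 h3; have [r' h4 h5] := path_encodes A.
  have er d : d < n -> r' d = r d.
    move=> hd; apply/eqP; rewrite eq_le.
    by rewrite ((traces_le h4 h1).1 _ d hd) ?((traces_le h1 h4).1 _ d hd).
  apply: (encodes_inj h2) h3; case: h5 => h6 h7; split=> // d hd.
  by have := h7 d hd; rewrite /reach er.
exists P, Q; split; [exact: code hP as_ es | exact: code hQ at_ et |].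
by apply/(traces_le hP hQ); apply: leq_of_bruhat as_ at_ es et hb.
Qed.
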